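(* Let $\big((X_i,d_i,\mathfrak m_i,p_i)\big)_{i\in\mathbb N}$ be a sequence of boundedly finite pointed Polish metric measure spaces. Then the sequence is precompact with respect to weak pointed measured Gromov--Hausdorff convergence (i.e. each of its subsequences has a wpmGH-converging subsequence) if and only if it is uniformly boundedly finite and boundedly measure-theoretically totally bounded, that is, if and only if $$\sup_{i\in\mathbb N}\mathfrak m_i\big(B(p_i,R)\big)<+\infty\quad\text{for every }R>0,$$ and for every $R,r,\varepsilon>0$ there exist $M\in\mathbb N$ and points $(x^i_n)_{n=1}^M\subset X_i$ (for each $i\in\mathbb N$) such that $$\sup_{i\in\mathbb N}\mathfrak m_i\Big(\bar B(p_i,R)\setminus\bigcup_{n=1}^MB(x^i_n,r)\Big)\le\varepsilon .$$
   Context: $B(x,r)$, $\bar B(x,r)$ are open/closed balls; $A^r:=\{x:{\rm dist}(x,A)<r\}$. A Polish metric measure space is a complete separable metric space with a Borel measure; pointed means a point is chosen (not required to be in the support of the measure); boundedly finite means the measure is finite on balls. $C_{bbs}(X)$ is the set of bounded continuous functions $X\to\mathbb R$ with bounded support. Weak $(R,\varepsilon)$-approximation ($0<\varepsilon<R$) from $(X,d_X,\mathfrak m_X,p_X)$ to $(Y,d_Y,\mathfrak m_Y,p_Y)$: a Borel map $\psi\colon B(p_X,R)\to Y$ with $\psi(p_X)=p_Y$ for which there is a Borel set $\tilde X\subset B(p_X,R)$ containing $p_X$ with (1) $|d_X(x,y)-d_Y(\psi(x),\psi(y))|\le\varepsilon$ for all $x,y\in\tilde X$; (2) $\mathfrak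 m_X(B(p_X,R)\setminus\tilde X)\le\varepsilon$ and $\mathfrak m_Y\big(B(p_Y,R-\varepsilon)\setminus\psi(\tilde X)^\varepsilon\big)\le\varepsilon$. Weak pointed measured Gromov--Hausdorff (wpmGH) convergence of $(X_i,d_i,\mathfrak m_i,p_i)$ to a boundedly finite pointed Polish metric measure space $(X_\infty,d_\infty,\mathfrak m_\infty,p_\infty)$: there are $R_i\nearrow+\infty$, $\varepsilon_i\searrow0$ and weak $(R_i,\varepsilon_i)$-approximations $\psi_i$ from $X_i$ to $X_\infty$ with $(\psi_i)_*\mathfrak m_i\rightharpoonup\mathfrak m_\infty$ in duality with $C_{bbs}(X_\infty)$, i.e. $\int_{B(p_i,R_i)}\varphi\circ\psi_i\,d\mathfrak m_i\to\int\varphi\,d\mathfrak m_\infty$ for all $\varphi\in C_{bbs}(X_\infty)$. *)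

(* Defs.v *)
From HB Require Import structures.
From mathcomp Require Import all_boot all_order all_algebra.
From mathcomp Require Import all_classical all_reals all_analysis.

Set Implicit Arguments.
Unset Strict Implicit.
Unset Printing Implicit Defensive.

Import Order.TTheory GRing.Theory Num.Theory.
Import numFieldNormedType.Exports.

Local Open Scope classical_set_scope.
Local Open Scope ring_scope.

#[short(type="completeMetricType")]
HB.structure Definition CompleteMetric (R : numDomainType) :=
  {T of CompletePseudoMetric R T & Metric R T}.

Notation borel T := (g_sigma_algebraType (@open T)).

Definition separable (T : topologicalType) : Prop :=
  exists2 D : set T, countable D & dense D.

(* The library's [point] of a [completeMetricType] only witnesses
   nonemptiness; the base point of the space is [pmm_point]. *)
Record pmmSpace (R : realType) := PMMSpace {
  pmm_carrier :> completeMetricType R ;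
  pmm_separable : separable pmm_carrier ;
  pmm_measure : {measure set (borel pmm_carrier) -> \bar R} ;
  pmm_point : pmm_carrier }.

Section metric_notions.
Context {R : realType} {T : metricType R}.

(* The library's [closed_ball] is the closure of the open ball, which can be
   smaller in a general metric space. *)
Definition cball (x : T) (r : R) : set T := [set y | mdist x y <= r].

Definition thickening (A : set T) (r : R) : set T :=
  [set x | (edist_inf A x < r%:E)%E].

Definition metric_bounded (A : set T) : Prop :=
  exists (x : T) (r : R), A `<=` ball x r.

Definition Cbbs (phi : T -> R) : Prop :=
  [/\ continuous phi, bounded_fun phi &
      metric_bounded (closure [set x | phi x != 0])].

End metric_notions.

Section weak_convergence.
Context {R : realType}.
Implicit Types X Y : pmmSpace R.

Definition boundedly_finite X : Prop :=
  forall (x : X) (r : R), (pmm_measure X (ball x r) < +oo)%E.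

(* A map defined on the ball of radius [r] is a total function whose values
   outside that ball are never used. *)
Definition weak_approximation X Y (r e : R) (psi : X -> Y) : Prop :=
  [/\ 0 < e < r,
      measurable_fun (ball (pmm_point X) r : set (borel X))
        (psi : borel X -> borel Y),
      psi (pmm_point X) = pmm_point Y &
      exists X' : set X,
        [/\ measurable (X' : set (borel X)),
            X' `<=` ball (pmm_point X) r,
            X' (pmm_point X),
            (forall x y, X' x -> X' y ->
               `|mdist x y - mdist (psi x) (psi y)| <= e) &
            (pmm_measure X (ball (pmm_point X) r `\` X') <= e%:E)%E /\
            (pmm_measure Y (ball (pmm_point Y) (r - e) `\`
                            thickening (psi @` X') e) <= e%:E)%E]].

Definition wpmGH_cvg (X : nat -> pmmSpace R) (Y : pmmSpace R) : Prop :=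
  boundedly_finite Y /\
  exists (r e : R^nat) (psi : forall i, X i -> Y),
    [/\ nondecreasing_seq r /\ r @ \oo --> +oo,
        nonincreasing_seq e /\ e @ \oo --> 0,
        (forall i, weak_approximation (r i) (e i) (psi i)) &
        forall phi : Y -> R, Cbbs phi ->
          (\int[pmm_measure (X i)]_(x in ball (pmm_point (X i)) (r i))
              (phi (psi i x))%:E)%E @[i --> \oo]
          --> (\int[pmm_measure Y]_x (phi x)%:E)%E].

Definition wpmGH_precompact (X : nat -> pmmSpace R) : Prop :=
  forall s : nat -> nat, increasing_seq s ->
  exists2 t : nat -> nat, increasing_seq t &
  exists Y : pmmSpace R, wpmGH_cvg (X \o s \o t) Y.

Definition uniformly_boundedly_finite (X : nat -> pmmSpace R) : Prop :=
  forall r : R, 0 < r ->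
  (ereal_sup [set pmm_measure (X i) (ball (pmm_point (X i)) r) | i in [set: nat]]
   < +oo)%E.

Definition boundedly_mt_totally_bounded (X : nat -> pmmSpace R) : Prop :=
  forall r0 r e : R, 0 < r0 -> 0 < r -> 0 < e ->
  exists (M : nat) (x : forall i, 'I_M -> X i),
  (ereal_sup [set pmm_measure (X i) (cball (pmm_point (X i)) r0 `\`
                    \bigcup_(n in [set: 'I_M]) ball (x i n) r)
             | i in [set: nat]]
   <= e%:E)%E.

End weak_convergence.

(* Main.v *)
(** Necessity: along a convergent subsequence, test the convergence of the
    push-forward measures against a continuous cutoff, possibly vanishing near
    finitely many balls that cover most of the limit; the approximations being
    almost isometric on sets of almost full measure, bounds on the mass and on
    the number of balls needed pull back to the tail of the sequence, so no
    diagonal choice of bad indices can have a convergent subsequence.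

    Sufficiency: fix an ultrafilter on [nat] containing all tails. At level [k],
    finitely many balls of radius [eta k] cover a ball of radius [k + 1] of
    every space up to mass [eta k]. The limit space is the completion of the
    set of all ball centers for the ultralimit of their distances. Recording
    the integer part of the distance to the base point and then, level by
    level, the first ball containing a point splits each space into nested
    cells. The ultralimits of the masses of the cells are the lengths of nested
    half-open intervals of the real line, so that almost every real [u] codes
    a sequence of centers converging to a point [limit_map u], and the limit
    measure is the push-forward of the Lebesgue measure by [limit_map]. Finally
    [psi_k] maps a point to the limit of the center of its ball of level [k]:
    its integrals are finite sums over cells, comparable to integrals on the
    line to which dominated convergence applies, which avoids any compactness
    theorem for measures. *)

Require Import Defs.
From HB Require Import structures.
From mathcomp Require Import all_boot all_order all_algebra.
From mathcomp Require Import all_classical all_reals all_analysis.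
From mathcomp Require Import measurable_realfun ring lra zify.

Set Implicit Arguments.
Unset Strict Implicit.
Unset Printing Implicit Defensive.

Import Order.TTheory GRing.Theory Num.Theory.
Import numFieldNormedType.Exports.

Local Open Scope classical_set_scope.
Local Open Scope ring_scope.

(** * Completion of a pseudometric space *)

Record pseudodist (R : realType) (I : Type) := Pseudodist {
  pdist :> I -> I -> R ;
  pdist_origin : I ;
  pdistxx : forall a, pdist a a = 0 ;
  pdist_sym : forall a b, pdist a b = pdist b a ;
  pdist_triangle : forall b a c, pdist a c <= pdist a b + pdist b c }.

Section completion.
Context {R : realType} {I : Type} (d : pseudodist R I).

(* A point of the completion is encoded by its distances to all the points
   of the pseudometric space. *)
Definition is_profile (f : I -> R) : Prop :=
  forall e, 0 < e -> exists a, forall b, `|f b - d a b| <= e.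

Record completion := Completion {
  profile :> I -> R ;
  profileP : is_profile profile }.

HB.instance Definition _ := gen_eqMixin completion.
HB.instance Definition _ := gen_choiceMixin completion.

Lemma is_profile_pdist a : is_profile (d a).
Proof. by move=> e e0; exists a => b; rewrite subrr normr0 ltW. Qed.

(** The Kuratowski embedding; it identifies points at pseudodistance zero. *)
Definition completion_inj (a : I) : completion :=
  Completion (@is_profile_pdist a).

HB.instance Definition _ := isPointed.Build completion
  (completion_inj (pdist_origin d)).

Let gaps (f g : completion) : set R := [set `|f b - g b| | b in setT].

Let cdist (f g : completion) : R := sup (gaps f g).

Let pdist_lip a b c : `|d a c - d b c| <= d a b.
Proof.
have := pdist_triangle d b a c; have := pdist_triangle d a b c.
by rewrite (pdist_sym d b a) ler_norml; lra.
Qed.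

(** Profiles may be unbounded, but each is uniformly close to a distance function, and [d a] and
    [d b] differ by at most [d a b]; so the sup distance is finite. *)
Let has_sup_gaps f g : has_sup (gaps f g).
Proof.
split; first by exists `|f (pdist_origin d) - g (pdist_origin d)|, (pdist_origin d).
have [a fa] := profileP f (@ltr01 R).
have [b gb] := profileP g (@ltr01 R).
exists (2 + d a b) => _ [c _ <-].
have := fa c; have := gb c; have := pdist_lip a b c.
by rewrite !ler_norml; lra.
Qed.

Let cdist_ge (f g : completion) b : `|f b - g b| <= cdist f g.
Proof. by apply: ub_le_sup; [have [] := has_sup_gaps f g|exists b]. Qed.

Let cdist_le (f g : completion) e : (forall b, `|f b - g b| <= e) -> cdist f g <= e.
Proof.
move=> h; apply: ge_sup; first by have [] := has_sup_gaps f g.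
by move=> _ [b _ <-].
Qed.

Let cdistxx f : cdist f f = 0.
Proof.
apply/eqP; rewrite eq_le cdist_le ?(le_trans _ (cdist_ge f f (pdist_origin d)))//.
by move=> b; rewrite subrr normr0.
Qed.

Let cdist_positivity f g : cdist f g = 0 -> f = g.
Proof.
move=> fg; have : profile f = profile g.
  by apply/funext => b; apply/eqP; rewrite -subr_eq0 -normr_le0 -fg cdist_ge.
case: f g {fg} => f pf [g pg] /= fg; subst g.
by rewrite (Prop_irrelevance pf pg).
Qed.

Let cdist_sym f g : cdist f g = cdist g f.
Proof.
by apply/eqP; rewrite eq_le !cdist_le// => b; rewrite distrC cdist_ge.
Qed.

Let cdist_triangle (g f h : completion) : cdist f h <= cdist f g + cdist g h.
Proof.
apply: cdist_le => b.
rewrite (le_trans (ler_distD (g b) _ _))//.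
by rewrite lerD// cdist_ge.
Qed.

HB.instance Definition _ := isMetric.Build R completion
  cdistxx cdist_positivity cdist_sym cdist_triangle.

Lemma completion_mdist_le (f g : completion) e :
  (forall b, `|f b - g b| <= e) -> mdist f g <= e.
Proof. exact: cdist_le. Qed.

Lemma completion_mdist_ge (f g : completion) b :
  `|f b - g b| <= mdist f g.
Proof. exact: cdist_ge. Qed.

Lemma completion_mdist_inj a b :
  mdist (completion_inj a) (completion_inj b) = d a b.
Proof.
apply/eqP; rewrite eq_le completion_mdist_le => [|c]; last exact: pdist_lip.
have := completion_mdist_ge (completion_inj a) (completion_inj b) b.
by rewrite /= pdistxx subr0; apply: le_trans; exact: ler_norm.
Qed.

Lemma completion_approx (f : completion) e :
  0 < e -> exists a, mdist (completion_inj a) f < e.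
Proof.
move=> e0; have [a fa] := profileP f (divr_gt0 e0 (ltr0n R 2)).
exists a; apply: (@le_lt_trans _ _ (e / 2)); last by lra.
by apply: completion_mdist_le => b; rewrite distrC.
Qed.

Lemma completion_dense : dense [set completion_inj a | a in setT].
Proof.
move=> U [f Uf] oU; have /nbhs_ballP[e /= e0 eU] : nbhs f U.
  by rewrite nbhsE; exists U.
have [a af] := completion_approx f e0.
exists (completion_inj a); split; last by exists a.
by apply: eU; apply: ball_sym; rewrite ballEmdist.
Qed.

(** A Cauchy filter is uniformly Cauchy as a family of functions, so it converges uniformly to its
    pointwise limit [l], and a uniform limit of profiles is a profile. *)
Let completion_complete (F : set_system completion) :
  ProperFilter F -> cauchy F -> cvg F.
Proof.
move=> PF /cauchyP Fc.
have ev e : 0 < e ->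
    exists f : completion, \forall g \near F, forall b, `|f b - profile g b| <= e.
  move=> e0; have [f Ff] := Fc e e0; exists f.
  apply: filterS Ff => g; rewrite ballEmdist /= => fg b.
  by rewrite (le_trans (completion_mdist_ge _ _ _))// ltW.
have cvb b : cvg ((fun g : completion => g b) @ F).
  apply: cauchy_cvg; apply: cauchy_exP => e e0.
  have [f Ff] := ev (e / 2) (divr_gt0 e0 (ltr0n R 2)).
  exists (f b); rewrite /= /nbhs /=.
  apply: filterS Ff => g /(_ b) fg; rewrite /ball /= .
  by apply: le_lt_trans fg _; lra.
pose l b := lim ((fun g : completion => g b) @ F).
have lev (f : completion) e : (\forall g \near F, forall b, `|f b - profile g b| <= e) ->
    forall b, `|f b - l b| <= e.
  move=> fe b.
  have h : (fun g : completion => `|f b - g b|) @ F --> `|f b - l b|.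
    by apply: cvg_norm; apply: cvgB; [exact: cvg_cst|exact: cvb].
  by apply: (cvgr_to_le h); apply: filterS fe => g; exact.
have lp : is_profile l.
  move=> e e0; have [f fe] := ev (e / 2) (divr_gt0 e0 (ltr0n R 2)).
  have [a fa] := profileP f (divr_gt0 e0 (ltr0n R 2)).
  exists a => b; have := fa b; have := lev _ _ fe b.
  by rewrite !ler_norml; lra.
apply/cvg_ex; exists (Completion lp).
apply/metricType_numDomainType.fcvgrPdist_lt => e e0.
have e40 : 0 < e / 4 by lra.
have [f fe] := ev (e / 4) e40.
have fl := lev _ _ fe.
apply: filterS fe => g fg; apply: (@le_lt_trans _ _ (e / 2)); last by lra.
apply: completion_mdist_le => b /=; have := fg b; have := fl b.
by rewrite !ler_norml; lra.
Qed.

HB.instance Definition _ := Uniform_isComplete.Build completion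
  completion_complete.

End completion.

(** * Nested intervals with prescribed lengths *)

Section code_realization.
Context {R : realType} (L : nat -> nat) (mu : nat -> nat -> R).
Hypothesis L_gt0 : forall k, (0 < L k)%N.
Hypothesis mu_ge0 : forall k w, 0 <= mu k w.
Hypothesis mu_children : forall k w,
  mu k w = \sum_(c < L k) mu k.+1 (w * L k + c)%N.

(* The interval of the cell [w] of level [k] starts at [a k w]; the numbering
   of the children of [w] by [w * L k + c] makes the order lexicographic. *)
Let a k w := \sum_(0 <= v < w) mu k v.

Let a0 k : a k 0 = 0.
Proof. by rewrite /a big_geq. Qed.

Let aS k w : a k w.+1 = a k w + mu k w.
Proof. by rewrite /a big_nat_recr. Qed.

Let a_mono k v w : (v <= w)%N -> a k v <= a k w.
Proof.
move=> vw; rewrite /a [leRHS](big_cat_nat (n := v)) //= lerDl.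
by apply: sumr_ge0 => *; exact: mu_ge0.
Qed.

(** The children of the first [w] cells of level [k] are the first [w * L k] cells of level [k.+1]
    and have the same total mass, so every endpoint survives refinement. *)
Let a_refine k w : a k.+1 (w * L k)%N = a k w.
Proof.
elim: w => [|w IH]; first by rewrite mul0n /a !big_geq.
rewrite aS -IH /a mulSnr (big_cat_nat (n := (w * L k)%N)) ?leq_addr//=.
congr (_ + _); rewrite mu_children -{1}[(w * L k)%N]add0n big_addn addKn big_mkord.
by apply: eq_bigr => c _; rewrite addnC.
Qed.

(** Here [p] counts the descendants at level [k] of one root cell. *)
Let a_root k : exists2 p, (0 < p)%N & forall w, a k (w * p)%N = a 0 w.
Proof.
elim: k => [|k [p p0 IH]]; first by exists 1%N => // w; rewrite muln1.
exists (p * L k)%N; first by rewrite muln_gt0 p0 L_gt0.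
by move=> w; rewrite mulnA a_refine IH.
Qed.

Let cell k w : set R := `[a k w, a k w.+1[%classic.

Let cell_unique k u v w : cell k v u -> cell k w u -> v = w.
Proof.
rewrite /cell /= !in_itv /= => /andP[v1 v2] /andP[w1 w2].
apply/eqP; rewrite eqn_leq; apply/andP; split; rewrite leqNgt; apply/negP => h.
  by have := a_mono k h; lra.
by have := a_mono k h; lra.
Qed.

Let D : set R := \bigcup_w cell 0 w.

(** The cell is the one ending at the first endpoint beyond [u]; [a_root] shows that such an
    endpoint exists at level [k]. Together with [cell_D], this says that all levels tile the same
    set [D]. *)
Let D_cell k u : D u -> exists w, cell k w u.
Proof.
move=> [w _]; rewrite /cell /= in_itv /= => /andP[u1 u2].
have [p _ ap] := a_root k.
have ex : exists w, u < a k w by exists (w.+1 * p)%N; rewrite ap.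
case: (ex_minnP ex) => -[|m] um hm.
  exfalso; move: um; have := a_mono 0 (leq0n w); rewrite !a0 => ? ?.
  by lra.
exists m; rewrite in_itv /= um andbT leNgt; apply/negP => /hm.
by rewrite ltnn.
Qed.

Let cell_D k w : cell k w `<=` D.
Proof.
move=> u; rewrite /cell /= in_itv /= => /andP[u1 u2].
have [p p0 ap] := a_root k.
have ex : exists v, u < a 0 v.
  exists w.+1; rewrite -ap; apply: (lt_le_trans u2); apply: a_mono.
  by rewrite leq_pmulr.
case: (ex_minnP ex) => -[|m] um hm.
  exfalso; move: um; have := a_mono k (leq0n w); rewrite !a0 => ? ?.
  by lra.
exists m => //; rewrite /cell /= in_itv /= um andbT leNgt; apply/negP => /hm.
by rewrite ltnn.
Qed.

Let N k u := xget 0%N [set w | cell k w u].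

Let N_cell k u : D u -> cell k (N k u) u.
Proof.
move=> /(D_cell k)[w cw]; apply: (@xgetPex _ 0%N [set w | cell k w u]).
by exists w.
Qed.

Let D_N k w : D `&` [set u | N k u = w] = cell k w.
Proof.
apply/seteqP; split => [u [Du <-]|u cu]; first exact: N_cell.
have Du := cell_D cu; split => //=.
exact: (cell_unique (N_cell k Du)).
Qed.

(** [C k u] is the index of the interval of level [k] containing [u]. A half-open interval that
    contains a point has positive length, so the last clause holds on all of [E]. *)
Lemma code_realization : exists (E : set R) (C : nat -> R -> nat),
  [/\ measurable E,
      (forall k w, measurable (E `&` [set u | C k u = w])),
      (forall k w, lebesgue_measure (E `&` [set u | C k u = w]) = (mu k w)%:E),
      (forall k u, E u -> C k u = C k.+1 u %/ L k)%N &
      forall k u, E u -> 0 < mu k (C k u)].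
Proof.
exists D, N; split.
- by apply: bigcup_measurable => w _; exact: measurable_itv.
- by move=> k w; rewrite D_N; exact: measurable_itv.
- move=> k w; rewrite D_N /cell lebesgue_measure_itv /= lte_fin -EFinB aS.
  case: ltP => h; first by congr (_%:E); lra.
  by congr (_%:E); have := mu_ge0 k w; move: h; rewrite ?aS; lra.
- move=> k u Du; apply: (@cell_unique k u); first exact: N_cell.
  have := N_cell k.+1 Du; rewrite /cell /= !in_itv /= => /andP[n1 n2].
  rewrite -[a k (_ %/ _)]a_refine -[a k _.+1]a_refine; apply/andP; split.
    by apply: le_trans n1; apply: a_mono; exact: leq_trunc_div.
  apply: (lt_le_trans n2); apply: a_mono.
  by rewrite ltn_ceil.
- move=> k u /(N_cell k); rewrite /cell /= in_itv /= aS => /andP[n1 n2].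
  by lra.
Qed.

End code_realization.
(** * Continuous functions and Borel sets *)

Section metric_topology.
Context {R : realType} {T : metricType R}.

Lemma metric_ball_open (x : T) (r : R) : open (ball x r).
Proof.
rewrite openE => y; rewrite ballEmdist /= => xy.
apply/nbhs_ballP; exists (r - mdist x y) => /=; first by rewrite subr_gt0.
move=> z; rewrite !ballEmdist /= => yz.
by have := metric_triangle x y z; lra.
Qed.

Lemma mdist_continuous (x : T) : continuous (mdist x).
Proof.
move=> y; apply/cvgrPdist_lt => e e0.
apply/nbhs_ballP; exists e => //= z; rewrite ballEmdist /= => yz.
have := metric_triangle x y z; have := metric_triangle x z y.
by rewrite (metric_sym z y) ltr_norml; lra.
Qed.

End metric_topology.

Section metric_borel.
Context {R : realType} {T : completeMetricType R}.

Lemma borel_open (U : set T) : open U -> measurable (U : set (borel T)).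
Proof. by move=> oU; rewrite /measurable /=; exact: sub_sigma_algebra. Qed.

Lemma borel_ball (x : T) (r : R) : measurable (ball x r : set (borel T)).
Proof. by apply: borel_open; exact: metric_ball_open. Qed.

Lemma borel_cball (x : T) (r : R) : measurable (cball x r : set (borel T)).
Proof.
rewrite (_ : cball x r = ~` [set z | r < mdist x z]).
  apply: measurableC; apply: borel_open.
  apply: (@open_comp _ _ (mdist x) [set t | r < t]); last exact: open_gt.
  by move=> z _; exact: mdist_continuous.
by apply/seteqP; split => z; rewrite /cball /= leNgt => /negP.
Qed.

Lemma borel_continuous (f : T -> R) :
  continuous f -> measurable_fun setT (f : borel T -> R).
Proof.
move=> cf; apply: (measurability _ (RGenOInfty.measurableE R)).
move=> _ [_ [a ->] <-]; rewrite setTI; apply: borel_open.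
by apply: open_comp; [move=> x _; exact: cf|exact: interval_open].
Qed.

End metric_borel.

(** * Continuous cutoffs with bounded support *)

Section bump.
Context {R : realType} {T : metricType R}.

Lemma ramp_exists (a b : R) : a < b -> exists f : R -> R,
  [/\ continuous f, (forall t, 0 <= f t <= 1), (forall t, t <= a -> f t = 0)
    & forall t, b <= t -> f t = 1].
Proof.
move=> ab; have ab0 : 0 < b - a by lra.
exists (fun t => Num.min 1 (Num.max 0 ((t - a) / (b - a)))); split.
- have cq : continuous (fun t : R => (t - a) / (b - a)).
    move=> t; apply: cvgM; last exact: cvg_cst.
    by apply: cvgB; [exact: cvg_id|exact: cvg_cst].
  move=> t; apply: (@continuous_min R R (cst 1)
    (fun t => Num.max 0 ((t - a) / (b - a)))); first exact: cvg_cst.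
  apply: (@continuous_max R R (cst 0) (fun t => (t - a) / (b - a))).
    exact: cvg_cst.
  exact: cq.
- by move=> t; rewrite le_min ge_min le_max !lexx ler01.
- move=> t ta; have h : (t - a) / (b - a) <= 0.
    by rewrite pmulr_lle0 ?invr_gt0//; lra.
  rewrite (max_idPl h); apply/min_idPr; lra.
- move=> t bt; have h : 1 <= (t - a) / (b - a).
    by rewrite ler_pdivlMr//; lra.
  rewrite (@max_idPr _ _ 0 _ _); last by lra.
  exact/min_idPl.
Qed.

(** Induction on [N]: start from a radial cutoff around [p] and multiply by a ramp in the distance
    to each further point. *)
Lemma bump_exists (p : T) (s rho : R) (y : nat -> T) N : 0 < rho ->
  exists g : T -> R, [/\ continuous g, (forall z, 0 <= g z <= 1),
    (forall z, s + 1 <= mdist p z -> g z = 0),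
    (forall z n, (n < N)%N -> mdist (y n) z < rho -> g z = 0) &
    forall z, mdist p z <= s ->
      (forall n, (n < N)%N -> 2 * rho <= mdist (y n) z) -> g z = 1].
Proof.
move=> rho0; elim: N => [|N [g [gc g01 gs gy g1]]].
  have [|f [fc f01 f0 f1]] := @ramp_exists s (s + 1); first by lra.
  exists (fun z => 1 - f (mdist p z)); split => //.
  - move=> z; apply: cvgB; first exact: cvg_cst.
    apply: (@continuous_comp _ _ _ (mdist p) f); last exact: fc.
    exact: mdist_continuous.
  - by move=> z; have := f01 (mdist p z); lra.
  - by move=> z /f1 ->; lra.
  - by move=> z /f0 -> _; lra.
have [|f [fc f01 f0 f1]] := @ramp_exists rho (2 * rho); first by lra.
exists (fun z => g z * f (mdist (y N) z)); split.
- move=> z; apply: cvgM; first exact: gc.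
  apply: (@continuous_comp _ _ _ (mdist (y N)) f); last exact: fc.
  exact: mdist_continuous.
- move=> z; have /andP[? ?] := g01 z; have /andP[? ?] := f01 (mdist (y N) z).
  by rewrite mulr_ge0//= mulr_ile1.
- by move=> z /gs ->; rewrite mul0r.
- move=> z n; rewrite ltnS leq_eqVlt => /orP[/eqP -> /ltW/f0 ->|nN /(gy _ _ nN) ->].
    by rewrite mulr0.
  by rewrite mul0r.
- move=> z zs zn; rewrite g1// ?f1 ?mulr1//; first exact: zn.
  by move=> n nN; apply: zn; exact: ltnW.
Qed.

Lemma Cbbs_bump (p : T) (s : R) (g : T -> R) : continuous g ->
  (forall z, 0 <= g z <= 1) -> (forall z, s <= mdist p z -> g z = 0) -> Cbbs g.
Proof.
move=> gc g01 gs; split => //.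
  exists 1; split; first exact: num_real.
  move=> M M1 z _ /=; have := g01 z; rewrite ler_norml; lra.
(* The margin 1 absorbs the closure: each of its points is within 1 of a point where [g] is
   nonzero. *)
exists p, (s + 1) => z /(_ (ball z 1)) [|w []].
  exact: nbhsx_ballx.
rewrite !ballEmdist /= => gw zw.
have : mdist p w < s by rewrite ltNge; apply: contra_neqN gw => /gs.
by have := metric_triangle p w z; rewrite (metric_sym w z); lra.
Qed.

End bump.
(** * Necessity *)

Lemma separable_dense_seq (R : realType) (T : completeMetricType R) :
  separable T ->
  exists y : nat -> T, forall z (r : R), 0 < r -> exists n, ball z r (y n).
Proof.
move=> [D cD dD].
have hit z r : 0 < r -> exists2 w, ball z r w & D w.
  move=> r0; have [||w [zw Dw]] := dD (ball z r); last by exists w.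
  - by exists z; exact: ballxx.
  - exact: metric_ball_open.
have /pfcard_geP[D0|[f]] := cD.
  by have [w _] := hit point 1 ltr01; rewrite D0.
exists f => z r /(hit z)[w zw Dw].
by have [n _ fn] := @surj _ _ _ _ f w Dw; exists n; rewrite fn.
Qed.

Section necessity.
Context {R : realType}.
Implicit Types Y Z : pmmSpace R.

(** The centers form a sequence rather than a tuple, so that [N] can grow without changing them. *)
Definition coverable Z (s r e : R) (N : nat) : Prop :=
  exists x : nat -> Z, (pmm_measure Z (ball (pmm_point Z) s `\`
    \bigcup_(n in [set n | (n < N)%N]) ball (x n) r) <= e%:E)%E.

Lemma borel_ball_diff Z (p : Z) (x : nat -> Z) (s r : R) N :
  measurable (ball p s `\` \bigcup_(n in [set n | (n < N)%N]) ball (x n) r :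
    set (borel Z)).
Proof.
apply: measurableD; first exact: borel_ball.
by apply: bigcup_measurable => n _; exact: borel_ball.
Qed.

Lemma coverable_le Z s r e N N' : (N <= N')%N ->
  coverable Z s r e N -> coverable Z s r e N'.
Proof.
move=> NN' [x hx]; exists x; apply: le_trans hx.
apply: le_measure; rewrite ?inE; [exact: borel_ball_diff..|].
apply: setDS => z [n /= nN xz]; exists n => //=; exact: leq_trans NN'.
Qed.

(** The parts of the ball missed by the first [N] balls around a dense sequence decrease to the
    empty set; continuity from above applies because the ball has finite mass. *)
Lemma boundedly_finite_coverable Z s r e : boundedly_finite Z ->
  0 < r -> 0 < e -> exists N, coverable Z s r e N.
Proof.
move=> Zf r0 e0; have [y yd] := separable_dense_seq (@pmm_separable _ Z).
pose F N := ball (pmm_point Z) s `\`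
  \bigcup_(n in [set n | (n < N)%N]) ball (y n) r.
have F0 : \bigcap_N F N = set0.
  rewrite -subset0 => z zF.
  have [n zyn] := yd z r r0; have [_] := zF n.+1 I; apply.
  by exists n => //=; exact: ball_sym.
have : pmm_measure Z \o F @ \oo --> pmm_measure Z (\bigcap_N F N).
  apply: nonincreasing_cvg_mu.
  - apply: le_lt_trans (Zf (pmm_point Z) s); apply: le_measure; rewrite ?inE.
    + exact: borel_ball_diff.
    + exact: borel_ball.
    + exact: subDsetl.
  - by move=> i; exact: borel_ball_diff.
  - by rewrite F0; exact: measurable0.
  - move=> n m nm; apply/subsetPset; apply: setDS => z [k /= kn yz].
    by exists k => //=; exact: leq_trans nm.
have e0' : (0 < e%:E)%E by rewrite lte_fin.
rewrite F0 measure0 => /(_ _ (open_ereal_lt' e0'))[N _ /(_ N (leqnn N)) NF].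
by exists N, y; exact: ltW.
Qed.

(** Transfers mass bounds from [Y] to [Z i]. On the part of [B] inside [X'] the function [g \o psi]
    is 1, so the mass of this part is at most an integral that is eventually below [c]; the rest of
    [B] lies in the part discarded by the approximation, of mass at most [eps]. *)
Lemma wpmGH_cvg_test (Z : nat -> pmmSpace R) Y (g : Y -> R) (s c eps : R) :
  wpmGH_cvg Z Y -> Cbbs g -> (forall z, 0 <= g z) ->
  (\int[pmm_measure Y]_z (g z)%:E < c%:E)%E -> 0 < eps ->
  \forall i \near \oo, exists (X' : set (Z i)) (psi : Z i -> Y),
    [/\ X' (pmm_point (Z i)), psi (pmm_point (Z i)) = pmm_point Y,
        (forall x y, X' x -> X' y ->
          `|mdist x y - mdist (psi x) (psi y)| <= eps) &
        forall B : set (Z i), measurable (B : set (borel (Z i))) ->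
          B `<=` ball (pmm_point (Z i)) s ->
          (forall x, B x -> X' x -> g (psi x) = 1) ->
          (pmm_measure (Z i) B <= (c + eps)%:E)%E].
Proof.
move=> [Yf [r [e [psi [[_ rT] [_ e0] wa gcv]]]]] gC g0 gc eps0.
have near_c := gcv _ gC _ (open_ereal_lt' gc).
have near_e : \forall i \near \oo, e i <= eps.
  exact: (cvgr_le _ e0).
have near_r : \forall i \near \oo, s <= r i.
  by move/cvgryPge : rT; exact.
near=> i.
have [_ mpsi psip [X' [mX' X'b X'p X'd [mZ _]]]] := wa i.
have si : s <= r i by near: i; exact: near_r.
have ei : e i <= eps.
  by near: i; exact: near_e.
exists X', (psi i); split => //.
  by move=> x y xX yX; exact: le_trans (X'd x y xX yX) ei.
move=> B mB Bs Bg.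
have mBX : measurable (B `&` X' : set (borel (Z i))) by exact: measurableI.
have bs : ball (pmm_point (Z i)) s `<=` ball (pmm_point (Z i)) (r i).
  exact: le_ball.
have mg : measurable_fun (ball (pmm_point (Z i)) (r i) : set (borel (Z i)))
    (fun x : borel (Z i) => (g (psi i x))%:E).
  apply/measurable_EFinP.
  apply: (@measurable_comp _ _ _ (borel (Z i)) (borel Y) _ setT) => //.
  by apply: borel_continuous; case: gC.
have le1 : (pmm_measure (Z i) (B `&` X') <= c%:E)%E.
  apply: (@le_trans _ _ (\int[pmm_measure (Z i)]_(x in
    ball (pmm_point (Z i)) (r i)) (g (psi i x))%:E)%E); last first.
    by apply: ltW; near: i; exact: near_c.
  apply: (@le_trans _ _ (\int[pmm_measure (Z i)]_(x in B `&` X')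
    (g (psi i x))%:E)%E); last first.
    apply: ge0_subset_integral => //; first exact: borel_ball.
      by move=> x _; rewrite lee_fin.
    by move=> x [/Bs/bs].
  rewrite -[leLHS]mul1e -(integral_cst _ mBX).
  apply: ge0_le_integral => //.
  - apply: (measurable_funS (borel_ball _ _) _ mg).
    by move=> x [/Bs/bs].
  - by move=> x [xB xX]; rewrite /= Bg.
have sub : B `<=` (B `&` X') `|` (ball (pmm_point (Z i)) (r i) `\` X').
  move=> x xB; case: (pselect (X' x)) => xX; [by left|right].
  by split => //; exact/bs/Bs.
apply: (@le_trans _ _ (pmm_measure (Z i)
  ((B `&` X') `|` (ball (pmm_point (Z i)) (r i) `\` X')))).
  apply: le_measure => //; rewrite inE //; apply: measurableU => //.
  by apply: measurableD => //; exact: borel_ball.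
apply: (le_trans (measureU2 _ _ _)) => //.
  by apply: measurableD => //; exact: borel_ball.
rewrite EFinD; apply: leeD => //; apply: (le_trans mZ).
by rewrite lee_fin.
Unshelve. all: by end_near. Qed.

Lemma bump_integral_le Y (g : Y -> R) (A : set Y) : measurable (A : set (borel Y)) ->
  continuous g -> (forall z, 0 <= g z <= 1) -> (forall z, ~ A z -> g z = 0) ->
  (\int[pmm_measure Y]_z (g z)%:E <= pmm_measure Y A)%E.
Proof.
move=> mA gc g01 gA.
rewrite -[A in leRHS](setIT A) -(@integral_indic _ (borel Y))//.
apply: (@ge0_le_integral _ (borel Y)) => //.
- by move=> x _; rewrite lee_fin; have /andP[] := g01 x.
- by apply/measurable_EFinP; exact: borel_continuous.
- by apply/measurable_EFinP; exact: measurable_indic.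
- move=> x _; rewrite lee_fin indicE; have /andP[? ?] := g01 x.
  by case: (asboolP (A x)) => Ax; [rewrite mem_set|rewrite memNset// gA].
Qed.

Lemma wpmGH_cvg_bounded (Z : nat -> pmmSpace R) Y (s : R) : wpmGH_cvg Z Y ->
  exists C : R, \forall i \near \oo,
    (pmm_measure (Z i) (ball (pmm_point (Z i)) s) <= C%:E)%E.
Proof.
move=> ZY; have [Yf _] := ZY.
(* No ball is removed here ([N] is 0). With error 1, points of the ball of radius [s] are sent
   within [s + 1] of the base point, where [g] is 1; [g] vanishes from [s + 2] on. *)
have [g [gc g01 gs _ g1]] :=
  @bump_exists _ _ (pmm_point Y) (s + 1) 1 (cst point) 0 ltr01.
have gC : Cbbs g by exact: (Cbbs_bump gc g01 gs).
have Ig := Yf (pmm_point Y) (s + 2).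
have {}Ig : (\int[pmm_measure Y]_z (g z)%:E < +oo)%E.
  apply: le_lt_trans Ig; apply: bump_integral_le => //; first exact: borel_ball.
  by move=> z; rewrite ballEmdist /= => /negP; rewrite -leNgt => ?; apply: gs; lra.
have I0 : (0 <= \int[pmm_measure Y]_z (g z)%:E)%E.
  by apply: integral_ge0 => z _; rewrite lee_fin; have /andP[] := g01 z.
pose c := fine (\int[pmm_measure Y]_z (g z)%:E)%E + 1.
have Ic : (\int[pmm_measure Y]_z (g z)%:E < c%:E)%E.
  by rewrite -[ltLHS]fineK ?ge0_fin_numE// lte_fin ltrDl.
exists (c + 1).
have := @wpmGH_cvg_test Z Y g s c 1 ZY gC _ Ic ltr01.
move=> /(_ (fun z => proj1 (andP (g01 z)))); apply: filterS => i.
move=> [X' [psi [X'p psip X'd h]]]; apply: h => //; first exact: borel_ball.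
move=> x; rewrite ballEmdist /= => xs Xx; apply: g1 => //.
have := X'd _ _ X'p Xx; rewrite psip ler_norml; lra.
Qed.

(** The cutoff vanishes near balls that almost cover a ball of [Y], so its integral is small. A
    point of [X'] missed by the chosen balls of [Z i] has its image far from every [y n], where the
    cutoff is 1; [wpmGH_cvg_test] then bounds the mass of such points. *)
Lemma wpmGH_cvg_coverable (Z : nat -> pmmSpace R) Y (s r e : R) :
  wpmGH_cvg Z Y -> 0 < r -> 0 < e ->
  exists N, \forall i \near \oo, coverable (Z i) s r e N.
Proof.
move=> ZY r0 e0; have [Yf _] := ZY.
(* Two points of [X'] whose images are within [2 * rho] of the same [y n] are at distance less than
   [4 * rho + eps], hence less than [r] since [eps <= r / 4]. *)
pose rho := r / 8; have rho0 : 0 < rho by rewrite /rho; lra.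
have [N [y hy]] : exists N, coverable Y (s + 2) rho (e / 4) N.
  by apply: boundedly_finite_coverable => //; lra.
have [g [gc g01 gs gy g1]] := @bump_exists _ _ (pmm_point Y) (s + 1) rho y N rho0.
have gC : Cbbs g by exact: (Cbbs_bump gc g01 gs).
have Ic : (\int[pmm_measure Y]_z (g z)%:E < (e / 2)%:E)%E.
  apply: (@le_lt_trans _ _ (e / 4)%:E); last by rewrite lte_fin; lra.
  apply: le_trans hy; apply: bump_integral_le => //; first exact: borel_ball_diff.
  move=> z /not_andP[].
    by rewrite ballEmdist /= => /negP; rewrite -leNgt => ?; apply: gs; lra.
  move=> /contrapT[n nN]; rewrite ballEmdist; exact: gy.
pose eps := Num.min (Num.min 1 (e / 2)) (r / 4).
have eps0 : 0 < eps by rewrite /eps !lt_min; lra.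
have [eps1 epse epsr] : [/\ eps <= 1, eps <= e / 2 & eps <= r / 4].
  by rewrite /eps !ge_min !lexx !orbT.
exists N.
have := @wpmGH_cvg_test Z Y g s (e / 2) eps ZY gC _ Ic eps0.
move=> /(_ (fun z => proj1 (andP (g01 z)))); apply: filterS => i.
move=> [X' [psi [X'p psip X'd h]]].
(* The [n]-th center is any point of [X'] with image near [y n]; the base point is a default when
   there is none. *)
pose P n x := X' x /\ mdist (y n) (psi x) < 2 * rho.
exists (fun n => xget (pmm_point (Z i)) (P n)).
apply: (@le_trans _ _ (e / 2 + eps)%:E); last by rewrite lee_fin; lra.
apply: h; first exact: borel_ball_diff.
  exact: subDsetl.
move=> x [xs xB] Xx; apply: g1.
  have := X'd _ _ X'p Xx; move: xs; rewrite ballEmdist /= psip ler_norml; lra.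
move=> n nN; rewrite leNgt; apply/negP => yx; apply: xB.
exists n; first exact: nN.
rewrite ballEmdist /=.
have [Xz yz] : P n (xget (pmm_point (Z i)) (P n)) by apply: xgetPex; exists x.
set z := xget _ _ in Xz yz *.
have := metric_triangle (psi z) (y n) (psi x); rewrite (metric_sym (psi z) (y n)).
have := X'd _ _ Xz Xx; rewrite ler_norml.
move: yz yx epsr; rewrite /rho; lra.
Qed.

End necessity.

(** * Extraction of subsequences *)

Lemma increasing_choice (P : nat -> nat -> Prop) :
  (forall k n, exists i, (n <= i)%N /\ P k i) ->
  exists2 s : nat -> nat, increasing_seq s & forall k, P k (s k).
Proof.
move=> far; pose next k n := sval (cid (far k n)).
have nextP k n : (n <= next k n)%N /\ P k (next k n) by rewrite /next; case: cid.
pose fix s k := if k is k'.+1 then next k (s k').+1 else next 0%N 0%N.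
exists s; last by case=> [|k]; exact: (nextP _ _).2.
by apply/increasing_seqP => k; exact: (nextP k.+1 (s k).+1).1.
Qed.

(** Each index fails [P] from some threshold on, so some threshold [b] is failed by all the indices
    below [N]; a witness for [maxn b n] therefore lies at [N] or beyond. *)
Lemma increasing_diagonal (P : nat -> nat -> Prop) :
  (forall n m i, (n <= m)%N -> P m i -> P n i) ->
  (forall n, exists i, P n i) -> (forall i, exists n, ~ P n i) ->
  exists2 s : nat -> nat, increasing_seq s & forall k, P k (s k).
Proof.
move=> anti ex fin; apply: increasing_choice => n N.
have [b hb] : exists b, forall i, (i < N)%N -> ~ P b i.
  elim: N => [|N [b hb]]; first by exists 0%N.
  have [c hc] := fin N; exists (maxn b c) => i; rewrite ltnS leq_eqVlt.
  case/orP => [/eqP ->|iN] Pi.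
    by apply: hc; exact: (anti _ _ _ (leq_maxr _ _) Pi).
  by apply: (hb i iN); exact: (anti _ _ _ (leq_maxl _ _) Pi).
have [i Pi] := ex (maxn b n); exists i.
split; last exact: (anti _ _ _ (leq_maxr _ _) Pi).
rewrite leqNgt; apply/negP => /hb; apply; exact: (anti _ _ _ (leq_maxl _ _) Pi).
Qed.

Section necessity_main.
Context {R : realType}.

Lemma increasing_seq_ge (t : nat -> nat) k : increasing_seq t -> (k <= t k)%N.
Proof.
move=> /increasing_seqP tS; elim: k => // k IH.
exact: leq_ltn_trans IH (tS k).
Qed.

Lemma wpmGH_precompact_bounded (X : nat -> pmmSpace R) :
  (forall i, boundedly_finite (X i)) -> wpmGH_precompact X ->
  uniformly_boundedly_finite X.
Proof.
move=> hX pX r r0; rewrite ltey; apply/eqP => supX.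
pose m i := pmm_measure (X i) (ball (pmm_point (X i)) r).
have [| | |s sI sP] := @increasing_diagonal (fun n i => (n%:R%:E < m i)%E).
- by move=> n k i nk; apply: le_lt_trans; rewrite lee_fin ler_nat.
- move=> n; apply: contrapT => /forallNP h.
  suff : (+oo <= n%:R%:E :> \bar R)%E by rewrite leye_eq.
  rewrite -supX; apply: ge_ereal_sup => _ [i _ <-].
  by rewrite leNgt; apply/negP; exact: h.
- move=> i; exists (Num.trunc (fine (m i))).+1 => h.
  have mi : m i \is a fin_num by rewrite ge0_fin_numE// hX.
  move: h; rewrite -[m i]fineK// lte_fin => h.
  by have := truncnS_gt (fine (m i)); lra.
have [t tI [Y XY]] := pX s sI.
have [C [N _ hC]] := wpmGH_cvg_bounded r XY.
pose k := maxn N (Num.trunc C).+1.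
have := hC k (leq_maxl _ _); rewrite leNgt => /negP; apply.
apply: le_lt_trans (sP (t k)); rewrite lee_fin.
apply: le_trans (ltW (truncnS_gt C)) _; rewrite ler_nat.
by apply: leq_trans (increasing_seq_ge k tI); exact: leq_maxr.
Qed.

Lemma wpmGH_precompact_totally_bounded (X : nat -> pmmSpace R) :
  (forall i, boundedly_finite (X i)) -> wpmGH_precompact X ->
  boundedly_mt_totally_bounded X.
Proof.
move=> hX pX s r e s0 r0 e0.
(* The open ball of radius [s + 1] contains the closed ball of radius [s]. *)
have [N hN] : exists N, forall i, coverable (X i) (s + 1) r e N.
  apply: contrapT => /forallNP noN.
  have [| | |u uI uP] :=
      @increasing_diagonal (fun n i => ~ coverable (X i) (s + 1) r e n).
  - move=> n k i nk; apply: contra_not; exact: coverable_le.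
  - by move=> n; have /existsNP := noN n.
  - move=> i; have [n hn] := boundedly_finite_coverable (s + 1) (hX i) r0 e0.
    by exists n; exact.
  have [t tI [Y XY]] := pX u uI.
  have [N [K _ hN]] := wpmGH_cvg_coverable (s + 1) XY r0 e0.
  pose k := maxn N K.
  apply: (uP (t k)); apply: coverable_le (hN k (leq_maxr _ _)).
  by apply: leq_trans (increasing_seq_ge k tI); exact: leq_maxl.
exists N, (fun i n => sval (cid (hN i)) n).
apply: ge_ereal_sup => _ [i _ <-]; case: (cid (hN i)) => x /= hx.
apply: le_trans hx; apply: le_measure; rewrite ?inE; last first.
- apply: setDSS => [z|z [n /= nN xz]]; last by exists (Ordinal nN).
  by rewrite /cball ballEmdist /=; lra.
- exact: borel_ball_diff.
- apply: measurableD; first exact: borel_cball.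
  by apply: borel_open; apply: bigcup_open => n _; exact: metric_ball_open.
Qed.

End necessity_main.
(** * Codes *)

Section fibers.
Context d (T : measurableType d) (R : realType).
Variables (m : {measure set T -> \bar R}) (E : set T) (N : T -> nat).
Hypothesis mN : forall w, measurable (E `&` [set x | N x = w]).

Lemma measurable_fibers (Q : set nat) :
  measurable (E `&` [set x | Q (N x)]).
Proof.
rewrite (_ : _ `&` _ = \bigcup_(w in Q) (E `&` [set x | N x = w])).
  by apply: bigcup_measurable => w _; exact: mN.
apply/seteqP; split => [x [Ex Qx]|x [w Qw [Ex /= Nw]]]; last by rewrite -Nw in Qw.
by exists (N x).
Qed.

Lemma measurable_fun_fibers d' (T' : measurableType d') (g : nat -> T') (Q : set nat) :
  measurable_fun (E `&` [set x | Q (N x)]) (g \o N).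
Proof.
by move=> _ B _; rewrite -setIA; exact: (@measurable_fibers (Q `&` g @^-1` B)).
Qed.

Lemma measure_fibers (Q : pred nat) n :
  m (E `&` [set x | (N x < n)%N && Q (N x)]) =
  (\sum_(w < n | Q w) m (E `&` [set x | N x = w]))%E.
Proof.
elim: n => [|n IH].
  by rewrite big_ord0 (_ : _ `&` _ = set0) ?measure0// -subset0 => x [].
rewrite big_mkcond big_ord_recr -big_mkcond -IH /=.
rewrite (_ : _ `&` _ = (E `&` [set x | (N x < n)%N && Q (N x)]) `|`
    (E `&` [set x | Q n /\ N x = n])).
  rewrite measureU.
  - congr (_ + _)%E; case: ifPn => Qn.
      by congr (m _); apply/seteqP; split => x [Ex] => [[_]|] Nn.
    by rewrite (_ : _ `&` _ = set0) ?measure0// -subset0 => x [_ []].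
  - exact: (@measurable_fibers [set w | (w < n)%N && Q w]).
  - exact: (@measurable_fibers [set w | Q n /\ w = n]).
  - by rewrite -subset0 => x [[_ /andP[h _]] [_ [_ Nn]]]; rewrite Nn ltnn in h.
apply/seteqP; split => [x [Ex]|x []].
  rewrite /= ltnS leq_eqVlt => /andP[/orP[/eqP <- Qn|lt Qn]]; first by right.
  by left; split => //=; rewrite lt.
- by move=> [Ex /= /andP[lt Qx]]; split => //=; rewrite ltnW.
- by move=> [Ex /= [Qn Nn]]; split => //=; rewrite Nn ltnSn.
Qed.

Lemma integral_fibers (f : nat -> R) n :
  (\int[m]_(x in E `&` [set x | (N x < n)%N]) (f (N x))%:E =
   \sum_(w < n) (f w)%:E * m (E `&` [set x | N x = w]))%E.
Proof.
elim: n => [|n IH].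
  by rewrite big_ord0 (_ : _ `&` _ = set0) ?integral_set0// -subset0 => x [].
rewrite big_ord_recr -IH /=.
have -> : E `&` [set x | (N x < n.+1)%N] =
    (E `&` [set x | (N x < n)%N]) `|` (E `&` [set x | N x = n]).
  apply/seteqP; split => [x [Ex]|x []].
    by rewrite /= ltnS leq_eqVlt => /orP[/eqP <-|lt]; [right|left].
  - by move=> [Ex /= lt]; split => //=; rewrite ltnW.
  - by move=> [Ex /= Nn]; split => //=; rewrite Nn.
rewrite integral_setU.
- congr (_ + _)%E; rewrite -integral_cst//; apply: eq_integral => x.
  by rewrite inE => -[_ ->].
- exact: (@measurable_fibers [set w | (w < n)%N]).
- exact: mN.
- rewrite -setIUr; exact: (@measurable_fun_fibers _ _ (EFin \o f)
    [set w | (w < n)%N \/ w = n]).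
- by apply/disj_setPS => x [[_ /= lt] [_ /= Nn]]; rewrite Nn ltnn in lt.
Qed.

End fibers.

Lemma cvg_sumr (R : realType) (F : set_system nat) (I : Type) (r : seq I)
    (P : pred I) (f : I -> nat -> R) (l : I -> R) : Filter F ->
  (forall i, P i -> f i @ F --> l i) ->
  (fun n => \sum_(i <- r | P i) f i n) @ F --> \sum_(i <- r | P i) l i.
Proof. by move=> FF; apply: cvg_big; exact: add_continuous. Qed.

(** The image ultrafilter lives on the compact segment [[- C, C]], where every ultrafilter
    converges. *)
Lemma ultra_cvg (R : realType) (F : set_system nat) (f : nat -> R) (C : R) :
  UltraFilter F -> (forall i, `|f i| <= C) -> f @ F --> lim (f @ F).
Proof.
move=> FU fC; have FP := @ultra_proper _ _ FU; have := @segment_compact R (- C) C.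
rewrite compact_ultra => /(_ (f @ F)) h; have [||l [_ fl]] := h.
(* The image is an ultrafilter: the preimage of [A] or that of its complement belongs to [F]. *)
- split => [|G PG FG]; first exact: fmap_proper_filter.
  apply/seteqP; split => [A GA|//].
  have [//|FnA] := in_ultra_setVsetC (f @^-1` A) FU.
  exfalso; apply: (@filter_not_empty _ G).
  by rewrite -(setICr A); apply: filterI => //; exact: (FG _ FnA).
- apply: (@filterE _ F) => i; rewrite /= in_itv /= -ler_norml.
  exact: fC.
- by apply: cvgP; exact: fl.
Qed.

(** * Codes as words written in mixed radix *)

Section coherent.
Variable L : nat -> nat.
Hypothesis L_gt0 : forall k, (0 < L k)%N.

(** The values [a k] are the successive prefixes of one infinite word: passing from level [k] to
    [k.+1] appends a digit in base [L k]. *)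
Definition coherent (a : nat -> nat) := forall k, a k = (a k.+1 %/ L k)%N.

Lemma coherent_below a b l : coherent a -> coherent b -> a l = b l ->
  forall k, (k <= l)%N -> a k = b k.
Proof.
move=> ca cb; elim: l => [|l IH] abl k; first by rewrite leqn0 => /eqP ->.
rewrite leq_eqVlt => /orP[/eqP -> //|]; rewrite ltnS; apply: IH.
by rewrite ca cb abl.
Qed.

(** The descendants at level [k] of the first [j] root cells are an initial segment of the codes.
    Balls of integer radius around the base point can thus be read off at every level. *)
Lemma coherent_root a j k : coherent a ->
  (a k < j * \prod_(l < k) L l)%N = (a 0 < j)%N.
Proof.
move=> ca; elim: k => [|k <-]; first by rewrite big_ord0 muln1.
by rewrite big_ord_recr /= mulnA -ltn_divLR// -ca.
Qed.

End coherent.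

Section net_code.
Context {R : realType} (Z : pmmSpace R).
Variables (M : nat -> nat) (pt : nat -> nat -> Z) (eta : nat -> R).

(* The value [M k] stands for "x lies in none of the balls of level k". *)
Definition net_letter k (x : Z) : nat :=
  find (fun n => mdist (pt k n) x < eta k) (iota 0 (M k)).

(** The code of level [k] carries the letters of the levels below [k] only, so the letter of level
    [k] is the last digit of the code of level [k.+1]. *)
Fixpoint net_code k (x : Z) : nat :=
  if k is k'.+1 then (net_code k' x * (M k').+1 + net_letter k' x)%N
  else Num.trunc (mdist (pmm_point Z) x).

Lemma net_letter_le k x : (net_letter k x <= M k)%N.
Proof. by rewrite -[leqRHS](size_iota 0) find_size. Qed.

Lemma net_letter_near k x : (net_letter k x < M k)%N ->
  mdist (pt k (net_letter k x)) x < eta k.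
Proof.
move=> lM; have hs : has (fun n => mdist (pt k n) x < eta k) (iota 0 (M k)).
  by rewrite has_find size_iota.
by have := nth_find 0%N hs; rewrite nth_iota.
Qed.

Lemma net_letter_far k x n : (n < net_letter k x)%N -> eta k <= mdist (pt k n) x.
Proof.
move=> nl; have := before_find 0%N nl.
by rewrite nth_iota ?(leq_trans nl (net_letter_le k x))// add0n => /negbT; rewrite -leNgt.
Qed.

Lemma net_letterP k x n : net_letter k x = n <-> [/\ (n <= M k)%N,
  (forall i, (i < n)%N -> eta k <= mdist (pt k i) x) &
  ((n < M k)%N -> mdist (pt k n) x < eta k)].
Proof.
split=> [<-|[nM far near]].
  by split; [exact: net_letter_le|move=> i; exact: net_letter_far|exact: net_letter_near].
apply/eqP; rewrite eqn_leq; apply/andP; split; rewrite leqNgt; apply/negP => h.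
  have := net_letter_far h; rewrite leNgt near//.
  exact: leq_trans h (net_letter_le k x).
by have := far _ h; rewrite leNgt net_letter_near// (leq_trans h).
Qed.

Lemma net_code_modn k x : (net_code k.+1 x %% (M k).+1)%N = net_letter k x.
Proof. by rewrite /= modnMDl modn_small// ltnS net_letter_le. Qed.

Lemma net_code_coherent x : coherent (fun k => (M k).+1) (net_code^~ x).
Proof. by move=> k /=; rewrite divnMDl// divn_small ?addn0// ltnS net_letter_le. Qed.

Lemma net_code0_lt j x : (net_code 0 x < j)%N = (mdist (pmm_point Z) x < j%:R).
Proof. by rewrite /= truncn_lt_nat ?mdist_ge0. Qed.

Lemma measurable_net_letter k n :
  measurable ([set x | net_letter k x = n] : set (borel Z)).
Proof.
have [nM|Mn] := leqP n (M k); last first.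
  rewrite (_ : mkset _ = set0); first exact: measurable0.
  by rewrite -subset0 => x /= lx; have := net_letter_le k x; rewrite lx leqNgt Mn.
rewrite (_ : mkset _ = ~` (\bigcup_(i in [set i | (i < n)%N]) ball (pt k i) (eta k))
    `&` (if (n < M k)%N then ball (pt k n) (eta k) else setT)).
  apply: measurableI.
    by apply: measurableC; apply: bigcup_measurable => i _; exact: borel_ball.
  by case: ifP => _; [exact: borel_ball|exact: measurableT].
apply/seteqP; split => x.
  move=> /net_letterP[_ far near]; split.
    by move=> [i /far]; rewrite ballEmdist /= leNgt => /negP.
  by case: ifPn => // nM'; rewrite ballEmdist; exact: near.
move=> [far near]; apply/net_letterP; split => //.
  move=> i iltn; rewrite leNgt; apply/negP => ix; apply: far.
  by exists i => //; rewrite ballEmdist.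
by move: near; case: ifPn => // _; rewrite ballEmdist.
Qed.

Lemma measurable_net_code k w : measurable ([set x | net_code k x = w] : set (borel Z)).
Proof.
elim: k w => [|k IH] w.
  rewrite (_ : mkset _ = ball (pmm_point Z) w.+1%:R `\` ball (pmm_point Z) w%:R).
    by apply: measurableD; exact: borel_ball.
  rewrite !ballEmdist; apply/seteqP; split => x.
    move=> cw; rewrite /= -!net_code0_lt cw ltnn ltnSn; by split.
  rewrite /= -!net_code0_lt => -[xw /negP]; rewrite -leqNgt => wx.
  by apply/eqP; rewrite eqn_leq wx -ltnS xw.
rewrite (_ : mkset _ = [set x | net_code k x = (w %/ (M k).+1)%N] `&`
    [set x | net_letter k x = (w %% (M k).+1)%N]).
  by apply: measurableI; [exact: IH|exact: measurable_net_letter].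
apply/seteqP; split => x.
  by move=> cw; split; [rewrite /= net_code_coherent cw|rewrite /= -net_code_modn cw].
by move=> [/= -> ->]; rewrite -divn_eq.
Qed.

End net_code.
(** * The limit space *)

(** Push forward the restriction of [m] to [G]. Integrability on [G] suffices because the complement
    of [G] is null for the restriction. *)
Lemma restricted_pushforward d d' (T : measurableType d) (T' : measurableType d')
    (R : realType) (m : {measure set T -> \bar R}) (G : set T) (f : T -> T') :
  measurable G -> measurable_fun setT f ->
  exists m' : {measure set T' -> \bar R},
    (forall A, m' A = m (f @^-1` A `&` G)) /\
    (forall g : T' -> \bar R, measurable_fun setT g ->
      m.-integrable G (g \o f) ->
      (\int[m']_y g y = \int[m]_(x in G) g (f x))%E).
Proof.
move=> mG mf.
exists (measure_function_pushforward__canonical__measure_function_Measure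
  (mrestr m mG) mf); split => // g mg gi.
have gf : measurable_fun setT (g \o f) by exact: measurableT_comp.
have restrE h : (\int[mrestr m mG]_(x in G) h x = \int[m]_(x in G) h x)%E.
  by apply: eq_measure_integral => A mA AG; exact: (congr1 m (setIidl AG)).
have GC0 : mrestr m mG (~` G) = 0%E by rewrite /mrestr setICl measure0.
have gi' : (mrestr m mG).-integrable setT (g \o f).
  apply/integrableP; split => //.
  rewrite -(setUv G) ge0_integral_setU//=; last 3 first.
  - exact: measurableC.
  - by rewrite setUv; apply: measurableT_comp.
  - by apply/disj_setPS; rewrite setICr.
  rewrite [X in (_ + X)%E]null_set_integral//; last 2 first.
  - exact: measurableC.
  - by apply: measurable_funTS; apply: measurableT_comp.
  by rewrite adde0 restrE; have /integrableP[] := gi.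
rewrite integral_pushforward//= preimage_setT.
rewrite (negligible_integral (measurableC mG) measurableT gi' GC0).
by rewrite setDE setCK setTI restrE.
Qed.

(* The maps [f k] are measurable for every sigma-algebra on the target, as is
   the case of maps with countably many values. *)
Lemma measurable_fun_metric_lim d (T : measurableType d) (R : realType)
    (Y : completeMetricType R) (f : nat -> T -> Y) (g : T -> Y) :
  (forall k (A : set Y), measurable (f k @^-1` A)) ->
  (forall u, f ^~ u @ \oo --> g u) ->
  measurable_fun setT (g : T -> borel Y).
Proof.
move=> mf fg; apply: (@measurability _ _ T (borel Y) setT g (@open Y)); first by [].
move=> _ [U oU <-].
(* [g u] lies in [U] exactly when, for some [n], the balls of radius [n.+1%:R^-1] around [f k u] are
   contained in [U] for all large [k]. *)
pose V n := [set y | ball y n.+1%:R^-1 `<=` U].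
rewrite setTI (_ : _ @^-1` _ = \bigcup_n \bigcup_K \bigcap_(k in [set k | (K <= k)%N])
    (f k @^-1` V n)).
  apply: bigcupT_measurable => n; apply: bigcupT_measurable => K.
  apply: bigcap_measurable => [|k _]; last exact: mf.
  by exists K => /=.
apply/seteqP; split => u.
  move=> Ugu; have /nbhs_ballP[e /= e0 eU] : nbhs (g u) U by rewrite nbhsE; exists U.
  pose n := Num.trunc (2 / e).
  have ne : n.+1%:R^-1 < e / 2.
    rewrite -[e / 2]invrK ltf_pV2 ?posrE ?invr_gt0//; last by lra.
    by rewrite invf_div; exact: truncnS_gt.
  have /metricType_numDomainType.cvgrPdist_lt/(_ (e / 2)) := fg u.
  move=> /(_ (divr_gt0 e0 (ltr0n R 2)))[K _ hK].
  exists n => //; exists K => // k /= Kk y; rewrite ballEmdist /= => fy.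
  apply: eU; rewrite ballEmdist /=.
  have gf : mdist (g u) (f k u) < e / 2 := hK k Kk.
  have fy' := lt_trans fy ne.
  by have := metric_triangle (g u) (f k u) y; lra.
move=> [n _ [K _ fV]].
have n0 : 0 < n.+1%:R^-1 :> R by rewrite invr_gt0.
have /metricType_numDomainType.cvgrPdist_lt/(_ _ n0)[K' _ hK'] := fg u.
apply: (fV (maxn K K') (leq_maxl _ _)).
by rewrite ballEmdist /= metric_sym; exact: (hK' _ (leq_maxr _ _)).
Qed.

(** * Ultralimits of distances and of cell masses *)

Section ultralimit.
Context {R : realType} (X : nat -> pmmSpace R).
Variables (M : nat -> nat) (pt : forall i, nat -> nat -> X i) (eta mass : nat -> R).
Variable F : set_system nat.
Hypothesis FU : UltraFilter F.
Hypothesis pt0 : forall i k, pt i k 0 = pmm_point (X i).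
Hypothesis pt_bound : forall i k n,
  mdist (pmm_point (X i)) (pt i k n) <= k%:R + 2.
Hypothesis massP : forall i n,
  (pmm_measure (X i) (ball (pmm_point (X i)) n%:R) <= (mass n)%:E)%E.

Let FP : ProperFilter F. Proof. exact: ultra_proper. Qed.

Local Notation cd i := (net_code M (pt i) eta).
Local Notation lt i := (net_letter M (pt i) eta).
Local Notation L := (fun k => (M k).+1).
Local Notation P k := (\prod_(l < k) (M l).+1)%N.

Definition limit_dist (a b : nat * nat) : R :=
  lim ((fun i => mdist (pt i a.1 a.2) (pt i b.1 b.2)) @ F).

Lemma limit_dist_cvg a b :
  (fun i => mdist (pt i a.1 a.2) (pt i b.1 b.2)) @ F --> limit_dist a b.
Proof.
apply: (@ultra_cvg _ _ _ ((a.1%:R + 2) + (b.1%:R + 2))) => i.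
rewrite ger0_norm ?mdist_ge0//.
apply: le_trans (metric_triangle _ (pmm_point (X i)) _) _.
by rewrite metric_sym lerD.
Qed.

Lemma limit_distxx a : limit_dist a a = 0.
Proof.
rewrite /limit_dist (_ : (fun i => _) = cst 0) ?lim_cst//.
by apply/funext => i; rewrite mdistxx.
Qed.

Lemma limit_dist_sym a b : limit_dist a b = limit_dist b a.
Proof.
by rewrite /limit_dist; congr (lim (_ @ F)); apply/funext => i; exact: metric_sym.
Qed.

Lemma limit_dist_triangle b a c :
  limit_dist a c <= limit_dist a b + limit_dist b c.
Proof.
apply: (ler_cvg_to (limit_dist_cvg (a := a) (b := c))
  (cvgD (limit_dist_cvg (a := a) (b := b)) (limit_dist_cvg (a := b) (b := c)))).
by apply: nearW => i; exact: metric_triangle.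
Qed.

Definition limit_pseudodist : pseudodist R (nat * nat) :=
  Pseudodist (0, 0)%N limit_distxx limit_dist_sym limit_dist_triangle.

Definition limit_space : completeMetricType R := completion limit_pseudodist.

Definition limit_pt k n : limit_space := completion_inj limit_pseudodist (k, n).

Lemma mdist_limit_pt k n l n' :
  mdist (limit_pt k n) (limit_pt l n') = limit_dist (k, n) (l, n').
Proof. exact: completion_mdist_inj. Qed.

Lemma limit_pt0 k : limit_pt k 0 = limit_pt 0 0.
Proof.
apply: mdist_positivity; rewrite mdist_limit_pt /limit_dist /=.
rewrite (_ : (fun i => _) = cst 0) ?lim_cst//.
by apply/funext => i; rewrite !pt0 mdistxx.
Qed.

Lemma limit_space_separable : separable limit_space.
Proof.
exists (range (completion_inj limit_pseudodist)); last exact: completion_dense.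
exact: (card_le_trans (card_image_le _ _) (countableP _)).
Qed.

Definition cell_mass k w : R :=
  lim ((fun i => fine (pmm_measure (X i) [set x | cd i k x = w])) @ F).

Lemma net_code_root i k j x : (cd i k x < j * P k)%N = (mdist (pmm_point (X i)) x < j%:R).
Proof.
rewrite -(net_code0_lt M (pt i) eta).
exact: (@coherent_root L (fun=> ltn0Sn _) (fun k => cd i k x) j k
  (net_code_coherent _ _ _ _)).
Qed.

Lemma net_code_prefix_ball i k j (Q : pred nat) :
  (pmm_measure (X i) [set x | (cd i k x < j)%N && Q (cd i k x)] <= (mass j)%:E)%E.
Proof.
apply: le_trans (massP i j); apply: le_measure; rewrite ?inE.
- rewrite -[mkset _]setTI; apply: (@measurable_fibers _ (borel (X i)) setT (cd i k) _
    [set w | (w < j)%N && Q w]) => w.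
  by rewrite setTI; exact: measurable_net_code.
- exact: borel_ball.
- move=> x /= /andP[xj _]; rewrite ballEmdist /= -(@net_code_root i k).
  by apply: leq_trans xj _; rewrite leq_pmulr// prodn_gt0.
Qed.

Lemma net_code_cell_le i k w :
  (pmm_measure (X i) [set x | cd i k x = w] <= (mass w.+1)%:E)%E.
Proof.
apply: le_trans (net_code_prefix_ball i k w.+1 (pred1 w)).
apply: le_measure; rewrite ?inE.
- exact: measurable_net_code.
- rewrite -[mkset _]setTI; apply: (@measurable_fibers _ (borel (X i)) setT (cd i k) _
    [set v | (v < w.+1)%N && pred1 w v]) => v.
  by rewrite setTI; exact: measurable_net_code.
- by move=> x /= ->; rewrite ltnSn eqxx.
Qed.

Lemma net_code_cell_fin i k w :
  pmm_measure (X i) [set x | cd i k x = w] \is a fin_num.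
Proof.
rewrite ge0_fin_numE//; apply: le_lt_trans (net_code_cell_le i k w) _.
exact: ltry.
Qed.

Lemma cell_mass_cvg k w :
  (fun i => fine (pmm_measure (X i) [set x | cd i k x = w])) @ F --> cell_mass k w.
Proof.
apply: (@ultra_cvg _ _ _ (mass w.+1)) => i.
rewrite ger0_norm ?fine_ge0//.
by rewrite -lee_fin fineK ?net_code_cell_fin// net_code_cell_le.
Qed.

Lemma cell_mass_ge0 k w : 0 <= cell_mass k w.
Proof.
apply: (cvgr_to_ge (cell_mass_cvg (k := k) (w := w))).
by apply: nearW => i; exact: fine_ge0.
Qed.

Lemma net_code_prefix_sum i k n (Q : pred nat) :
  fine (pmm_measure (X i) [set x | (cd i k x < n)%N && Q (cd i k x)]) =
  \sum_(w < n | Q w) fine (pmm_measure (X i) [set x | cd i k x = w]).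
Proof.
rewrite -[X in pmm_measure _ X]setTI (@measure_fibers _ (borel (X i))); last first.
  by move=> w; rewrite setTI; exact: measurable_net_code.
rewrite sum_fine => [|w _]; last by rewrite net_code_cell_fin.
by congr fine; apply: eq_bigr => w _; rewrite setTI.
Qed.

Lemma cell_mass_sum k n (Q : pred nat) :
  (fun i => fine (pmm_measure (X i) [set x | (cd i k x < n)%N && Q (cd i k x)])) @ F
  --> \sum_(w < n | Q w) cell_mass k w.
Proof.
under eq_fun do rewrite net_code_prefix_sum.
by apply: cvg_sumr => w _; exact: cell_mass_cvg.
Qed.

(** In each space a cell is the disjoint union of its finitely many children, and ultralimits
    commute with finite sums. This is the compatibility required by [code_realization]. *)
Lemma cell_mass_children k w :
  cell_mass k w = \sum_(c < (M k).+1) cell_mass k.+1 (w * (M k).+1 + c)%N.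
Proof.
have h : (fun i => \sum_(c < (M k).+1) fine (pmm_measure (X i)
      [set x | cd i k.+1 x = w * (M k).+1 + c]%N)) @ F
    --> \sum_(c < (M k).+1) cell_mass k.+1 (w * (M k).+1 + c)%N.
  by apply: cvg_sumr => c _; exact: cell_mass_cvg.
apply: cvg_lim => //; apply: cvg_trans h; apply: near_eq_cvg; apply: nearW => i.
have mc v : measurable ([set x | cd i k x = w] `&` [set x | lt i k x = v] :
    set (borel (X i))).
  by apply: measurableI; [exact: measurable_net_code|exact: measurable_net_letter].
have := measure_fibers (pmm_measure (X i)) mc xpredT (M k).+1.
rewrite (_ : _ `&` _ = [set x | cd i k x = w]) => [->|]; last first.
  by apply/seteqP; split => [x []|x cx]//; split => //=; rewrite andbT ltnS net_letter_le.
have cE (c : 'I_(M k).+1) : [set x | cd i k x = w] `&` [set x | lt i k x = c] =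
    [set x | cd i k.+1 x = w * (M k).+1 + c]%N.
  apply/seteqP; split => x; first by move=> [/= -> ->].
  move=> /= h; have := net_code_modn M (pt i) eta k x.
  have := net_code_coherent M (pt i) eta x k.
  by rewrite /= h divnMDl// modnMDl divn_small// modn_small// addn0 => -> <-.
rewrite -sum_fine => [|c _]; last by rewrite cE net_code_cell_fin.
by apply: eq_bigr => c _; rewrite cE.
Qed.

(** * Points of the limit coded by real numbers *)

Hypothesis eta_gt0 : forall k, 0 < eta k.
Hypothesis eta_cvg0 : eta @ \oo --> 0.
Hypothesis eta_sum : (\sum_(k <oo) (eta k)%:E < +oo)%E.
Hypothesis pt_cover : forall i k,
  (pmm_measure (X i) [set x | ball (pmm_point (X i)) k.+1%:R x /\ lt i k x = M k]
   <= (eta k)%:E)%E.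

(** The data that [code_realization] produces from the masses [cell_mass]. *)
Variables (E : set R) (N : nat -> R -> nat).
Hypothesis mE : measurable E.
Hypothesis mN : forall k w, measurable (E `&` [set u | N k u = w]).
Hypothesis lebN : forall k w,
  lebesgue_measure (E `&` [set u | N k u = w]) = (cell_mass k w)%:E.
Hypothesis cohN : forall k u, E u -> N k u = (N k.+1 u %/ (M k).+1)%N.
Hypothesis posN : forall k u, E u -> 0 < cell_mass k (N k u).

Let FF : Filter F. Proof. exact: filter_filter. Qed.

Let coherentN u : E u -> coherent L (N ^~ u).
Proof. by move=> Eu k; exact: cohN. Qed.

Definition limit_letter k u := (N k.+1 u %% (M k).+1)%N.

(** A cell whose mass has a positive ultralimit is nonempty for [F]-almost all [i], and agreement of
    codes at level [l] implies agreement below it. *)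
Lemma limit_code_realized u l : E u ->
  \forall i \near F, exists x : X i, forall k, (k <= l)%N -> cd i k x = N k u.
Proof.
move=> Eu; have := @cvgr_gt _ _ F FF _ _ (@cell_mass_cvg l (N l u)) _ (posN l Eu).
apply: filterS => i mi.
have [x cx] : [set x | cd i l x = N l u] !=set0.
  by apply/set0P/eqP => c0; move: mi; rewrite c0 measure0 ltxx.
exists x; apply: (coherent_below (net_code_coherent _ _ _ _) (coherentN Eu)).
exact: cx.
Qed.

Lemma limit_letter_realized u l : E u ->
  \forall i \near F, exists2 x : X i, (cd i 0 x = N 0 u) &
    forall k, (k <= l)%N -> lt i k x = limit_letter k u.
Proof.
move=> Eu; apply: filterS (limit_code_realized l.+1 Eu) => i [x hx].
exists x; first exact: hx.
by move=> k kl; rewrite -net_code_modn hx.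
Qed.

Local Notation good k u := (limit_letter k u < M k)%N.

(** For [F]-almost all [i], some point of [X i] has the letters of [u] up to both levels and so lies
    in both balls; the triangle inequality passes to the ultralimit. *)
Lemma limit_pt_near u k l : E u -> good k u -> good l u ->
  mdist (limit_pt k (limit_letter k u)) (limit_pt l (limit_letter l u))
    <= eta k + eta l.
Proof.
move=> Eu gk gl; rewrite mdist_limit_pt.
apply: (cvgr_to_le (limit_dist_cvg (a := (_, _)) (b := (_, _)))).
apply: filterS (limit_letter_realized (maxn k l) Eu) => i [x _ hx] /=.
have lk := hx k (leq_maxl _ _); have ll := hx l (leq_maxr _ _).
rewrite -lk -ll; apply: le_trans (metric_triangle _ x _) _.
rewrite (metric_sym x) lerD// ltW// net_letter_near//.
  by rewrite lk.
by rewrite ll.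
Qed.

Lemma limit_pt_far u k : E u -> good k u ->
  (N 0 u)%:R - eta k <= mdist (limit_pt 0 0) (limit_pt k (limit_letter k u)).
Proof.
move=> Eu gk; rewrite mdist_limit_pt.
apply: (cvgr_to_ge (limit_dist_cvg (a := (_, _)) (b := (_, _)))).
apply: filterS (limit_letter_realized k Eu) => i [x x0 hx] /=.
have lk := hx k (leqnn k); rewrite -lk -x0 /= pt0.
have := @net_letter_near _ _ M (pt i) eta k x.
rewrite lk => /(_ gk); have := truncn_le (mdist (pmm_point (X i)) x).
have := metric_triangle (pmm_point (X i)) (pt i k (limit_letter k u)) x.
rewrite mdist_ge0; lra.
Qed.

(* The points of the first [k + 1] annuli missed by the balls of level [k];
   their measures are summable, whence Borel-Cantelli. *)
Definition bad_set k := E `&` [set u |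
  (N k.+1 u < k.+1 * P k.+1)%N && (limit_letter k u == M k)].

Lemma bad_setE k u : E u -> bad_set k u <-> (N 0 u <= k)%N /\ ~ good k u.
Proof.
move=> Eu; have lM : (limit_letter k u <= M k)%N by rewrite -ltnS ltn_pmod.
have root := @coherent_root L (fun=> ltn0Sn _) _ k.+1 k.+1 (coherentN Eu).
rewrite /bad_set /= root ltnS; split=> [[_ /andP[-> /eqP ->]]|[-> /negP gk]].
  by split => //; rewrite ltnn.
by split => //=; rewrite eqn_leq lM leqNgt.
Qed.

Lemma measurable_bad_set k : measurable (bad_set k).
Proof.
exact: (@measurable_fibers _ _ _ _ (@mN k.+1)
  [set v | (v < k.+1 * P k.+1)%N && (v %% (M k).+1 == M k)%N]).
Qed.

Lemma bad_set_mass k : (lebesgue_measure (bad_set k) <= (eta k)%:E)%E.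
Proof.
pose Q v := (v %% (M k).+1 == M k)%N.
rewrite (measure_fibers lebesgue_measure (@mN k.+1) Q).
rewrite (eq_bigr (fun w : 'I__ => (cell_mass k.+1 w)%:E)) => [|w _]; last exact: lebN.
rewrite sumEFin lee_fin.
apply: (cvgr_to_le (cell_mass_sum (k := k.+1) (Q := Q))).
apply: nearW => i; rewrite -lee_fin fineK; last first.
  rewrite ge0_fin_numE//; apply: le_lt_trans (ltry _).
  exact: net_code_prefix_ball.
(* In [X i] the cells concerned fill exactly the part of the ball of radius [k.+1] that lies in no
   ball of level [k]. *)
apply: le_trans (pt_cover i k); rewrite le_eqVlt; apply/orP; left; apply/eqP.
congr (pmm_measure _ _); apply/seteqP; split => x.
  by move=> /andP[]; rewrite net_code_root /Q net_code_modn ballEmdist => ? /eqP.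
by move=> [xb xM]; apply/andP; rewrite net_code_root /Q net_code_modn xM;
  split => //; move: xb; rewrite ballEmdist.
Qed.

Definition good_set := E `\` lim_sup_set bad_set.

Lemma measurable_lim_sup_bad_set : measurable (lim_sup_set bad_set).
Proof.
apply: bigcap_measurable => [|n _]; first by exists 0%N.
by apply: bigcup_measurable => k _; exact: measurable_bad_set.
Qed.

Lemma measurable_good_set : measurable good_set.
Proof. exact: measurableD mE measurable_lim_sup_bad_set. Qed.

Lemma lim_sup_bad_set_null : lebesgue_measure (lim_sup_set bad_set) = 0%E.
Proof.
apply: lim_sup_set_cvg0; first exact: measurable_bad_set.
apply: le_lt_trans eta_sum; apply: lee_nneseries => // k _.
by have := bad_set_mass k.
Qed.

(** Once [k] is at least [N 0 u], lying outside [bad_set k] means having a center at level [k]. *)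
Lemma good_set_eventually u : good_set u ->
  exists K, forall k, (K <= k)%N -> good k u.
Proof.
move=> [Eu /existsNP[n /not_implyP[_ nB]]]; exists (maxn n (N 0 u)) => k.
rewrite geq_max => /andP[nk Nk]; apply: contrapT => gk; apply: nB.
by exists k => //; apply/(bad_setE _ Eu).
Qed.
(** The constant value off [good_set] makes the sequence converge at every real, so that [limit_map]
    is measurable on the whole line. *)
Definition limit_map_at k u : limit_space :=
  if pselect (good_set u) then limit_pt k (limit_letter k u) else limit_pt 0 0.

Definition limit_map u : limit_space := lim (limit_map_at ^~ u @ \oo).

Lemma limit_map_atE k u : good_set u ->
  limit_map_at k u = limit_pt k (limit_letter k u).
Proof. by rewrite /limit_map_at; case: pselect. Qed.

Let eta_lt e : 0 < e -> exists K, forall k, (K <= k)%N -> eta k < e.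
Proof.
move=> e0; have : \forall k \near \oo, eta k < e.
  by apply: (cvgr_lt _ eta_cvg0).
by case=> K _ hK; exists K.
Qed.

Lemma limit_map_cvg u : limit_map_at ^~ u @ \oo --> limit_map u.
Proof.
apply: cauchy_cvg; apply: (@cauchy_exP R limit_space) => e e0.
have [gu|ngu] := pselect (good_set u); last first.
  exists (limit_pt 0 0); exists 0%N => // k _.
  rewrite /= (_ : limit_map_at k u = limit_pt 0 0); first exact: ballxx.
  by rewrite /limit_map_at; case: pselect.
have [K hK] := good_set_eventually gu.
have [K' hK'] := eta_lt (divr_gt0 e0 (ltr0n R 2)).
pose n := maxn K K'; exists (limit_map_at n u); exists n => // k /= nk.
rewrite /= ballEmdist /= !limit_map_atE//.
apply: (@le_lt_trans _ _ (eta n + eta k)).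
  apply: limit_pt_near; first by case: gu.
    by apply: hK; exact: leq_maxl.
  by apply: hK; exact: leq_trans (leq_maxl _ _) nk.
have := hK' n (leq_maxr _ _); have := hK' k (leq_trans (leq_maxr _ _) nk).
by lra.
Qed.

Lemma limit_map_dist u e : 0 < e -> exists K, forall k, (K <= k)%N ->
  mdist (limit_map u) (limit_map_at k u) < e.
Proof.
have /metricType_numDomainType.cvgrPdist_lt h := limit_map_cvg (u := u).
by move=> /h [K _ hK]; exists K.
Qed.

Lemma limit_map_near u k : good_set u -> good k u ->
  mdist (limit_map u) (limit_pt k (limit_letter k u)) <= eta k.
Proof.
move=> gu gk; apply/ler_addgt0Pl => e e0.
have e20 : 0 < e / 2 by lra.
have [K hK] := good_set_eventually gu.
have [K1 hK1] := eta_lt e20.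
have [K2 hK2] := limit_map_dist u e20.
pose l := maxn K (maxn K1 K2).
have := hK l (leq_maxl _ _).
have := hK1 l (leq_trans (leq_maxl _ _) (leq_maxr _ _)).
have := hK2 l (leq_trans (leq_maxr _ _) (leq_maxr _ _)).
rewrite limit_map_atE// => d2 d1 gl.
have [Eu _] := gu.
have := limit_pt_near Eu gl gk.
have := metric_triangle (limit_map u) (limit_pt l (limit_letter l u))
  (limit_pt k (limit_letter k u)).
by lra.
Qed.

(** The preimage of a ball thus meets finitely many root cells, which makes the limit measure finite
    on balls. *)
Lemma limit_map_far u : good_set u ->
  (N 0 u)%:R <= mdist (limit_pt 0 0) (limit_map u).
Proof.
move=> gu; apply/ler_addgt0Pl => e e0.
have e20 : 0 < e / 2 by lra.
have [K hK] := good_set_eventually gu.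
have [K1 hK1] := eta_lt e20.
pose l := maxn K K1.
have gl := hK l (leq_maxl _ _); have el := hK1 l (leq_maxr _ _).
have [Eu _] := gu.
have := limit_pt_far Eu gl; have := limit_map_near gu gl.
have := metric_triangle (limit_pt 0 0) (limit_map u) (limit_pt l (limit_letter l u)).
by lra.
Qed.

Lemma measurable_limit_map : measurable_fun setT (limit_map : R -> borel limit_space).
Proof.
apply: (@measurable_fun_metric_lim _ _ _ _ limit_map_at); last exact: limit_map_cvg.
move=> k A.
rewrite (_ : _ @^-1` _ =
  (good_set `&` (E `&` [set u | A (limit_pt k (limit_letter k u))])) `|`
  (~` good_set `&` [set u | A (limit_pt 0 0)])).
  apply: measurableU; apply: measurableI.
  - exact: measurable_good_set.
  - exact: (@measurable_fibers _ _ _ _ (@mN k.+1)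
      [set v | A (limit_pt k (v %% (M k).+1)%N)]).
  - by apply: measurableC; exact: measurable_good_set.
  - have [Ap|nAp] := pselect (A (limit_pt 0 0)).
      by rewrite (_ : mkset _ = setT)//; apply/seteqP; split.
    by rewrite (_ : mkset _ = set0)//; apply/seteqP; split.
apply/seteqP; split => u; rewrite /= /limit_map_at; case: pselect => gu /=.
- by move=> Au; left; split => //; split => //; have [] := gu.
- by move=> Ap; right.
- by case=> [[_ [_]]//|[]].
- by case=> [[]//|[_]].
Qed.

Lemma measure_initial_cells j :
  (lebesgue_measure (E `&` [set u | (N 0 u < j)%N]) < +oo)%E.
Proof.
rewrite (_ : mkset _ = [set u | (N 0 u < j)%N && xpredT (N 0 u)]); last first.
  by apply/seteqP; split => u /=; rewrite andbT.
rewrite (measure_fibers lebesgue_measure (@mN 0) xpredT).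
rewrite (eq_bigr (fun w : 'I__ => (cell_mass 0 w)%:E)) => [|w _]; last exact: lebN.
by rewrite sumEFin ltry.
Qed.

Lemma near_forall_lt (Q : nat -> nat -> Prop) m :
  (forall n, (n < m)%N -> \forall i \near F, Q n i) ->
  \forall i \near F, forall n, (n < m)%N -> Q n i.
Proof.
elim: m => [|m IH] h; first by apply: nearW.
have h1 := IH (fun n nm => h n (ltnW nm)); have h2 := h m (ltnSn m).
apply: filterS2 h1 h2 => i a b n; rewrite ltnS leq_eqVlt => /orP[/eqP ->//|].
exact: a.
Qed.

(** What the space [X i] must satisfy to serve at level [k]: the clauses yield, in order, the almost
    isometry, the almost surjectivity and the convergence of integrals. *)
Definition close_at k i := [/\
  forall n, (n < M k)%N -> forall n', (n' < M k)%N ->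
    `|mdist (pt i k n) (pt i k n') - limit_dist (k, n) (k, n')| < eta k,
  forall w, (w < k.+1 * P k.+1)%N -> 0 < cell_mass k.+1 w ->
    [set x | cd i k.+1 x = w] !=set0 &
  \sum_(w < k.+1 * P k.+1)
    `|fine (pmm_measure (X i) [set x | cd i k.+1 x = w]) - cell_mass k.+1 w|
    < eta k].

Lemma near_close_at k : \forall i \near F, close_at k i.
Proof.
have h1 : \forall i \near F, forall n, (n < M k)%N -> forall n', (n' < M k)%N ->
    `|mdist (pt i k n) (pt i k n') - limit_dist (k, n) (k, n')| < eta k.
  apply: near_forall_lt => n _; apply: near_forall_lt => n' _.
  have := limit_dist_cvg (a := (k, n)) (b := (k, n')).
  by move/cvgrPdist_lt/(_ _ (eta_gt0 k)); apply: filterS => i /=; rewrite distrC.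
have h2 : \forall i \near F, forall w, (w < k.+1 * P k.+1)%N ->
    0 < cell_mass k.+1 w -> [set x | cd i k.+1 x = w] !=set0.
  apply: near_forall_lt => w _.
  have [c0|c0] := ltP 0 (cell_mass k.+1 w); last by apply: nearW.
  have := @cvgr_gt _ _ F FF _ _ (@cell_mass_cvg k.+1 w) _ c0.
  apply: filterS => i mi _; apply/set0P/eqP => s0.
  by move: mi; rewrite s0 measure0 ltxx.
have h3 : \forall i \near F, \sum_(w < k.+1 * P k.+1)
    `|fine (pmm_measure (X i) [set x | cd i k.+1 x = w]) - cell_mass k.+1 w|
    < eta k.
  have s0 : (fun i => \sum_(w < k.+1 * P k.+1)
    `|fine (pmm_measure (X i) [set x | cd i k.+1 x = w]) - cell_mass k.+1 w|) @ F
    --> \sum_(w < k.+1 * P k.+1) (0 : R).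
    apply: cvg_sumr => w _; rewrite -(normr0 R); apply: cvg_norm.
    rewrite -(subrr (cell_mass k.+1 w)); apply: cvgB; last exact: cvg_cst.
    exact: cell_mass_cvg.
  have l0 : \sum_(w < k.+1 * P k.+1) (0 : R) = 0 by apply: big1.
  by rewrite l0 in s0; have := @cvgr_lt _ _ F FF _ _ s0 _ (eta_gt0 k).
by apply: filterS3 h1 h2 h3 => i a b c; split.
Qed.

(** * The limit measure, the approximations and weak convergence *)

Variable mY : {measure set (borel limit_space) -> \bar R}.
Hypothesis mYE : forall A, mY A = lebesgue_measure (limit_map @^-1` A `&` good_set).
Hypothesis mY_integral : forall g : borel limit_space -> \bar R,
  measurable_fun setT g -> lebesgue_measure.-integrable good_set (g \o limit_map) ->
  (\int[mY]_y g y = \int[lebesgue_measure]_(u in good_set) g (limit_map u))%E.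
Hypothesis eta_small : forall k, eta k <= 1 / 8.
Hypothesis M_gt0 : forall k, (0 < M k)%N.

Definition limit_pmm : pmmSpace R :=
  PMMSpace limit_space_separable mY (limit_pt 0 0).

Lemma limit_pmm_finite : boundedly_finite limit_pmm.
Proof.
move=> y r; rewrite /= mYE.
pose j := (Num.trunc (mdist (limit_pt 0 0) y + r)).+1.
apply: le_lt_trans (measure_initial_cells j); apply: le_measure; rewrite ?inE.
- apply: measurableI; last exact: measurable_good_set.
  rewrite -[X in measurable X]setTI; apply: measurable_limit_map => //.
  exact: borel_ball.
- exact: (@measurable_fibers _ _ _ _ (@mN 0) [set w | (w < j)%N]).
- move=> u [yu gu]; have [Eu _] := gu; split => //=.
  move: yu; rewrite /= ballEmdist /= => yu; rewrite -(ltr_nat R).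
  have := truncnS_gt (mdist (limit_pt 0 0) y + r); rewrite -/j.
  have := limit_map_far gu; have := metric_triangle (limit_pt 0 0) y (limit_map u).
  by lra.
Qed.

(** A point in no ball of level [k] goes to [limit_pt k (M k)]; such points are left out of the set
    on which the map is almost isometric. *)
Definition limit_approx i k (x : X i) : limit_pmm := limit_pt k (lt i k x).

(** Moving two points to their centers costs [2 * eta k] and passing to the limit distance costs
    [eta k], so [4 * eta k] leaves room. It is below [k.+1%:R] by [eta_small]. *)
Lemma limit_weak_approximation i k : close_at k i ->
  weak_approximation (k.+1%:R) (4 * eta k) (@limit_approx i k).
Proof.
move=> [c1 c2 _].
have p0 : lt i k (pmm_point (X i)) = 0%N.
  by apply/net_letterP; split => // _; rewrite pt0 mdistxx.
have mgood : measurable ([set x | (lt i k x < M k)%N] : set (borel (X i))).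
  rewrite -[mkset _]setTI; apply: (@measurable_fibers _ (borel (X i)) setT (lt i k) _
    [set w | (w < M k)%N]) => w.
  by rewrite setTI; exact: measurable_net_letter.
have k1 : 1 <= k.+1%:R :> R by rewrite ler1n.
have ek := eta_gt0 k; have e8 := eta_small k.
split.
- by apply/andP; split; lra.
- move=> _ A mA; apply: measurableI; first exact: borel_ball.
  rewrite -[X in measurable X]setTI.
  apply: (@measurable_fibers _ (borel (X i)) setT (lt i k) _
    [set w | A (limit_pt k w)]) => w.
  by rewrite setTI; exact: measurable_net_letter.
- by rewrite /limit_approx p0; exact: limit_pt0.
exists (ball (pmm_point (X i)) k.+1%:R `&` [set x | (lt i k x < M k)%N]); split.
- by apply: measurableI => //; exact: borel_ball.
- exact: subIsetl.
- by split; [apply: ballxx; lra|rewrite /= p0].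
- move=> x y [_ /= gx] [_ /= gy]; rewrite /limit_approx mdist_limit_pt.
  have := c1 _ gx _ gy; have := net_letter_near gx; have := net_letter_near gy.
  set px := pt i k (lt i k x); set py := pt i k (lt i k y) => yn xn.
  have := metric_triangle px x y; have := metric_triangle x px py.
  have := metric_triangle px y py; have := metric_triangle x py y.
  rewrite (metric_sym x px) (metric_sym y py) ltr_norml ler_norml; lra.
split.
- apply: (@le_trans _ _ (eta k)%:E); last by rewrite lee_fin; lra.
  apply: le_trans (pt_cover i k).
  apply: le_measure; rewrite ?inE.
  + apply: measurableD; first exact: borel_ball.
    by apply: measurableI => //; exact: borel_ball.
  + apply: measurableI; [exact: borel_ball|exact: measurable_net_letter].
  + move=> x [xb nx]; split => //; apply/eqP; rewrite eqn_leq net_letter_le leqNgt.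
    by apply/negP => gx; apply: nx.
- apply: (@le_trans _ _ (eta k)%:E); last by rewrite lee_fin; lra.
  rewrite mYE; apply: le_trans (bad_set_mass k).
  set psiX := thickening _ _.
  have mth : measurable (psiX : set (borel limit_space)).
    apply: borel_open.
    apply: (@open_comp _ _ _ [set y | (y < (4 * eta k)%:E)%E]);
      last exact: open_ereal_lt_ereal.
    by move=> z _; exact: edist_inf_continuous.
  apply: le_measure; rewrite ?inE.
  + apply: measurableI; last exact: measurable_good_set.
    rewrite -[X in measurable X]setTI; apply: measurable_limit_map => //.
    by apply: measurableD => //; exact: borel_ball.
  + exact: measurable_bad_set.
  + move=> u [[/= ub nth] gu]; have [Eu _] := gu; apply/(bad_setE _ Eu).
    have Nk : (N 0 u <= k)%N.
      move: ub; rewrite ballEmdist /= => ub.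
      rewrite -ltnS -(ltr_nat R); have := limit_map_far gu; lra.
    split => // gk; apply: nth; rewrite /psiX /thickening /=.
    have root := @coherent_root L (fun=> ltn0Sn _) _ k.+1 k.+1 (coherentN Eu).
    (* A point of [X i] with the code of [u] has the same letter, so its image is the center close
       to [limit_map u]. *)
    have [|x cx] := c2 (N k.+1 u) _ (posN k.+1 Eu); first by rewrite root ltnS.
    have lx : lt i k x = limit_letter k u by rewrite -net_code_modn cx.
    apply: (@le_lt_trans _ _ (edist (limit_map u, limit_approx k x))).
      apply: ereal_inf_lbound; exists (limit_approx k x) => //.
      exists x => //; split; last by rewrite /= lx.
      rewrite ballEmdist /= -(@net_code_root i k.+1) cx root.
      by rewrite ltnS.
    apply: (@le_lt_trans _ _ (2 * eta k)%:E); last by rewrite lte_fin; lra.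
    apply: edist_fin; first by lra.
    rewrite ballEmdist /= /limit_approx lx.
    by have := limit_map_near gu gk; lra.
Qed.
Lemma limit_integral_cvg (t : nat -> nat) (phi : limit_pmm -> R) :
  (forall k, close_at k (t k)) -> Cbbs phi ->
  (\int[pmm_measure (X (t k))]_(x in ball (pmm_point (X (t k))) k.+1%:R)
     (phi (limit_approx k x))%:E)%E @[k --> \oo]
  --> (\int[pmm_measure limit_pmm]_y (phi y)%:E)%E.
Proof.
move=> tc [phic phib phis].
have [C C0 phiC] : exists2 C, 0 <= C & forall z, `|phi z| <= C.
  have [C [_ hC]] := phib; exists (`|C| + 1); first by rewrite addr_ge0.
  by move=> z; apply: (hC (`|C| + 1)) => //; have := ler_norm C; lra.
have [J phiJ] : exists J : nat, forall z, J%:R <= mdist (limit_pt 0 0) z -> phi z = 0.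
  have [x [r xr]] := phis; exists (Num.trunc (mdist (limit_pt 0 0) x + r)).+1 => z.
  apply: contraPeq => pz; apply/negP; rewrite -ltNge.
  have := truncnS_gt (mdist (limit_pt 0 0) x + r).
  have : ball x r z by apply: xr; exact: subset_closure.
  by rewrite ballEmdist /=; have := metric_triangle (limit_pt 0 0) x z; lra.
have mphi : measurable_fun setT (EFin \o (phi : borel limit_space -> R)).
  by apply/measurable_EFinP; apply: (@borel_continuous R limit_space phi); exact: phic.
pose n k := (k.+1 * P k.+1)%N.
pose f k w := phi (limit_pt k (w %% (M k).+1)).
(* Removing the bad cells lets the support of [phi] bound the remaining ones. *)
pose f' k w := if (w %% (M k).+1 == M k)%N then 0 else f k w.
pose m k w := fine (pmm_measure (X (t k)) [set x | cd (t k) k.+1 x = w]).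
pose a k := \sum_(w < n k) f k w * m k w.
pose b k := \sum_(w < n k) f' k w * cell_mass k.+1 w.
have f'C k w : `|f' k w| <= C by rewrite /f'; case: ifP => _; rewrite ?normr0 ?phiC.
have aE k : (\int[pmm_measure (X (t k))]_(x in ball (pmm_point (X (t k))) k.+1%:R)
     (phi (limit_approx k x))%:E)%E = (a k)%:E.
  have mcd w : measurable ([set: borel (X (t k))] `&` [set x | cd (t k) k.+1 x = w]).
    by rewrite setTI; exact: measurable_net_code.
  transitivity (\int[pmm_measure (X (t k))]_(x in setT `&`
      [set x | (cd (t k) k.+1 x < n k)%N]) (f k (cd (t k) k.+1 x))%:E)%E.
    rewrite setTI (_ : ball _ _ = [set x | (cd (t k) k.+1 x < n k)%N]).
      by apply: eq_integral => x _; rewrite /f net_code_modn.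
    by apply/seteqP; split => x; rewrite ballEmdist /mkset /n net_code_root.
  rewrite (integral_fibers _ mcd) /a -sumEFin; apply: eq_bigr => w _.
  by rewrite setTI EFinM /m fineK// net_code_cell_fin.
(* Two errors: the masses in [X (t k)] differ little from their ultralimits by [close_at], and the
   bad cells removed in [f'] have total mass at most [eta k]. *)
have ab k : `|a k - b k| <= 2 * C * eta k.
  have [_ _ c3] := tc k.
  have -> : a k - b k = \sum_(w < n k) f k w * (m k w - cell_mass k.+1 w) +
      \sum_(w < n k) (f k w - f' k w) * cell_mass k.+1 w.
    by rewrite -big_split -sumrB; apply: eq_bigr => w _ /=; ring.
  have s1 : `|\sum_(w < n k) f k w * (m k w - cell_mass k.+1 w)| <= C * eta k.
    apply: le_trans (ler_norm_sum _ _ _) _.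
    apply: (@le_trans _ _ (C * \sum_(w < n k) `|m k w - cell_mass k.+1 w|)).
      by rewrite mulr_sumr; apply: ler_sum => w _; rewrite normrM ler_wpM2r ?phiC.
    by rewrite ler_wpM2l// ltW.
  have s2 : `|\sum_(w < n k) (f k w - f' k w) * cell_mass k.+1 w| <= C * eta k.
    apply: (@le_trans _ _ (C * \sum_(w < n k | (w %% (M k).+1 == M k)%N)
        cell_mass k.+1 w)).
      apply: le_trans (ler_norm_sum _ _ _) _.
      rewrite mulr_sumr [leRHS]big_mkcond; apply: ler_sum => w _.
      rewrite /f'; case: ifP => _; last by rewrite subrr mul0r normr0.
      rewrite subr0 normrM [X in _ * X <= _]ger0_norm ?cell_mass_ge0//.
      by rewrite ler_wpM2r ?cell_mass_ge0 ?phiC.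
    rewrite ler_wpM2l// -lee_fin; apply: le_trans (bad_set_mass k).
    pose Q v := (v %% (M k).+1 == M k)%N.
    rewrite (measure_fibers lebesgue_measure (@mN k.+1) Q).
    rewrite (eq_bigr (fun w : 'I__ => (cell_mass k.+1 w)%:E)) => [|w _]; last exact: lebN.
    by rewrite sumEFin.
  by have := ler_normD (\sum_(w < n k) f k w * (m k w - cell_mass k.+1 w))
    (\sum_(w < n k) (f k w - f' k w) * cell_mass k.+1 w); lra.
(* [g k] is the step function on the line with integral [b k]. *)
pose A k := E `&` [set u | (N k.+1 u < n k)%N].
pose g k u := (((EFin \o f' k \o N k.+1) \_ (A k)) u).
have bE k : (b k)%:E = (\int[lebesgue_measure]_(u in E) g k u)%E.
  rewrite -integral_mkcondr setIA setIid.
  apply: etrans (esym (integral_fibers lebesgue_measure (@mN k.+1) (f' k) (n k))).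
  rewrite /b -sumEFin; apply: eq_bigr => w _; rewrite EFinM.
  by congr (_ * _)%E; exact/esym/lebN.
have gE k u : E u -> g k u =
    if (N 0 u <= k)%N && good k u then (phi (limit_pt k (limit_letter k u)))%:E else 0%E.
  move=> Eu; rewrite /g patchE.
  have root := @coherent_root L (fun=> ltn0Sn _) _ k.+1 k.+1 (coherentN Eu).
  rewrite (_ : (u \in A k) = (N 0 u <= k)%N); last first.
    apply/idP/idP; rewrite inE /A /= /n root ltnS; first by case.
    by move=> ?; split.
  case: ifP => //= _; rewrite /f' /f /=.
  have : (limit_letter k u <= M k)%N by rewrite -ltnS ltn_pmod.
  rewrite -/(limit_letter k u) leq_eqVlt.
  by case: eqP => [->|] /=; rewrite ?ltnn// => _ ->.
(* By [limit_pt_far], a root letter of at least [J.+1] puts the center at distance at least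
   [J.+1%:R - eta k], hence beyond [J], where [phi] vanishes. So [C] times the indicator of this set
   of finite measure dominates every [g k]. *)
pose D := [set u | (N 0 u < J.+1)%N].
have mD : measurable (E `&` D).
  exact: (@measurable_fibers _ _ _ _ (@mN 0) [set w | (w < J.+1)%N]).
pose h u := (C * (\1_(E `&` D) u))%:E.
have mg k : measurable_fun E (g k).
  have mA : measurable (A k).
    exact: (@measurable_fibers _ _ _ _ (@mN k.+1) [set w | (w < n k)%N]).
  apply/(measurable_restrict _ mA mE); rewrite /A setIA setIid.
  exact: (@measurable_fun_fibers _ _ _ _ (@mN k.+1) _ _ (EFin \o f' k)
    [set w | (w < n k)%N]).
have hi : lebesgue_measure.-integrable E h.
  have i1 : lebesgue_measure.-integrable E (fun u => (\1_(E `&` D) u)%:E).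
    apply/integrableP; split.
      by apply/measurable_EFinP; exact: measurable_indic.
    under eq_integral do rewrite gee0_abs ?lee_fin//.
    rewrite integral_indic//; apply: le_lt_trans (measure_initial_cells J.+1).
    by apply: le_measure; rewrite ?inE//; exact: measurableI.
  have -> : h = (fun u => C%:E * (\1_(E `&` D) u)%:E)%E.
    by apply/funext => u; rewrite -EFinM.
  exact: integrableZl.
have gh k u : E u -> (`|g k u| <= h u)%E.
  move=> Eu; rewrite gE// /h indicE; case: ifPn => [/andP[Nk gk]|_]; last first.
    by rewrite abse0 lee_fin mulr_ge0.
  have [uD|nuD] := pselect (D u).
    by rewrite mem_set//= mulr1 lee_fin phiC.
  rewrite phiJ ?abse0 ?lee_fin ?mulr_ge0//.
  move: nuD; rewrite /D /= => /negP; rewrite -leqNgt -(ler_nat R) -natr1.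
  have := limit_pt_far Eu gk; have := eta_small k; lra.
have gcv u : E u -> good_set u -> g ^~ u @ \oo --> (phi (limit_map u))%:E.
  move=> Eu gu; have [K hK] := good_set_eventually gu.
  have c1 : (fun k => phi (limit_map_at k u)) @ \oo --> phi (limit_map u).
    by apply: (cvg_comp _ _ (limit_map_cvg (u := u))); exact: phic.
  have c2 : (phi (limit_map_at k u))%:E @[k --> \oo] --> (phi (limit_map u))%:E.
    by apply: cvg_EFin; [apply: nearW|exact: c1].
  apply: cvg_trans c2; apply: near_eq_cvg.
  exists (maxn K (N 0 u)) => // k /=; rewrite geq_max => /andP[Kk Nk].
  by rewrite gE// Nk hK//= limit_map_atE.
have mphiT : measurable_fun E (fun u => (phi (limit_map u))%:E).
  by apply: measurable_funTS; exact: (measurableT_comp mphi measurable_limit_map).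
have gae : {ae lebesgue_measure, forall u, E u ->
    g ^~ u @ \oo --> (phi (limit_map u))%:E}.
  exists (lim_sup_set bad_set); split.
  - exact: measurable_lim_sup_bad_set.
  - exact: lim_sup_bad_set_null.
  - move=> u /= nu; apply: contrapT => nb; apply: nu => Eu.
    exact: gcv Eu (conj Eu nb).
have ghae : {ae lebesgue_measure, forall u k, E u -> (`|g k u| <= h u)%E}.
  by apply: aeW => u k; exact: gh.
have [phi_int _ bcv] :=
  @dominated_convergence _ _ R lebesgue_measure E mE _ _ _ mg mphiT gae hi ghae.
(* [E] and [good_set] differ by a null set. *)
have IE : (\int[mY]_y (phi y)%:E =
    \int[lebesgue_measure]_(u in E) (phi (limit_map u))%:E)%E.
  rewrite (mY_integral mphi); last first.
    by apply: integrableS phi_int => //; [exact: measurable_good_set|exact: subDsetl].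
  exact/esym/(@negligible_integral _ (measurableTypeR R) R lebesgue_measure _ _ _
    measurable_lim_sup_bad_set mE phi_int lim_sup_bad_set_null).
under eq_fun do rewrite aE.
rewrite IE.
have -> : (fun k => (a k)%:E) = (fun k => (b k)%:E + (a k - b k)%:E)%E.
  by apply/funext => k; rewrite -EFinD addrC subrK.
have bI : (fun k => (b k)%:E) @ \oo -->
    (\int[lebesgue_measure]_(u in E) (phi (limit_map u))%:E)%E.
  apply: cvg_trans bcv; apply: near_eq_cvg; apply: nearW => k /=.
  by rewrite -bE.
have ab0 : (fun k => a k - b k) @ \oo --> 0.
  have c0 : (fun k => 2 * C * eta k) @ \oo --> 0.
    by rewrite -(mulr0 (2 * C)); apply: cvgM => //; exact: cvg_cst.
  apply: (@squeeze_cvgr _ _ _ _ (fun k => - (2 * C * eta k))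
    (fun k => 2 * C * eta k)) => //.
    by apply: nearW => k; rewrite -ler_norml.
  by rewrite -(oppr0 R); apply: cvgN.
have ab0E : (fun k => (a k - b k)%:E) @ \oo --> 0%E.
  by apply: cvg_EFin; [apply: nearW|exact: ab0].
have f0 : (0 : \bar R)%E \is a fin_num by [].
have := cvgeD (fin_num_adde_defl _ f0) bI ab0E.
by rewrite adde0; exact.
Qed.

End ultralimit.
(** * Sufficiency *)

Section sufficiency.
Context {R : realType} (X : nat -> pmmSpace R).

Lemma totally_bounded_nets (eta : nat -> R) :
  (forall k, 0 < eta k <= 1) -> boundedly_mt_totally_bounded X ->
  exists (M : nat -> nat) (pt : forall i, nat -> nat -> X i),
  [/\ (forall k, (0 < M k)%N),
      (forall i k, pt i k 0%N = pmm_point (X i)),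
      (forall i k n, mdist (pmm_point (X i)) (pt i k n) <= k%:R + 2) &
      forall i k, (pmm_measure (X i) [set x | ball (pmm_point (X i)) k.+1%:R x /\
         net_letter M (pt i) eta k x = M k] <= (eta k)%:E)%E].
Proof.
move=> eta01 btb.
have eta0 k : 0 < eta k by have /andP[] := eta01 k.
have [M hM] := choice (fun k =>
  btb k.+1%:R (eta k) (eta k) (ltr0Sn R k) (eta0 k) (eta0 k)).
pose x k := sval (cid (hM k)).
(* The base point is inserted at index 0, shifting the given centers by one, and replaces the
   centers too far away. No coverage is lost: a ball of radius [eta k <= 1] that meets the ball of
   radius [k.+1] has its center within [k + 2]. *)
pose pt i k n : X i := if n is n'.+1 then
  if insub n' : option 'I_(M k) is Some j then
    if mdist (pmm_point (X i)) (x k i j) < k%:R + 2 then x k i j else pmm_point (X i)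
  else pmm_point (X i) else pmm_point (X i).
exists (fun k => (M k).+1), pt; split => //.
  move=> i k [|n] /=; first by rewrite mdistxx addr_ge0.
  case: insub => [j|]; last by rewrite mdistxx addr_ge0.
  by case: ifPn => [/ltW//|_]; rewrite mdistxx addr_ge0.
move=> i k.
have hx : (pmm_measure (X i) (cball (pmm_point (X i)) k.+1%:R `\`
    \bigcup_(n in [set: 'I_(M k)]) ball (x k i n) (eta k)) <= (eta k)%:E)%E.
  apply: le_trans (svalP (cid (hM k))); apply: ereal_sup_ubound.
  by exists i.
apply: le_trans hx; apply: le_measure; rewrite ?inE.
- apply: measurableI; first exact: borel_ball.
  exact: measurable_net_letter.
- apply: measurableD; first exact: borel_cball.
  by apply: borel_open; apply: bigcup_open => n _; exact: metric_ball_open.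
move=> z [zb zl]; move: zb; rewrite /cball ballEmdist /= => zb.
split; first exact: ltW.
move=> [j _]; rewrite ballEmdist /= => jz.
have /andP[_ e1] := eta01 k.
have pj : mdist (pmm_point (X i)) (x k i j) < k%:R + 2.
  have := metric_triangle (pmm_point (X i)) z (x k i j).
  by rewrite (metric_sym z); move: zb; rewrite -natr1; lra.
have jl : (j.+1 < net_letter (fun k => (M k).+1) (pt i) eta k z)%N.
  by rewrite zl ltnS.
have := net_letter_far jl; rewrite /= valK pj.
by lra.
Qed.

Lemma uniformly_bounded_mass : uniformly_boundedly_finite X ->
  exists mass : nat -> R, forall i n,
    (pmm_measure (X i) (ball (pmm_point (X i)) n%:R) <= (mass n)%:E)%E.
Proof.
move=> ubf.
suff /choice[mass hm] : forall n, exists c : R, forall i,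
    (pmm_measure (X i) (ball (pmm_point (X i)) n%:R) <= c%:E)%E.
  by exists mass => i n; exact: hm.
move=> n; have := ubf n.+1%:R (ltr0Sn R n).
set S := ereal_sup _ => Sfin.
have le i : (pmm_measure (X i) (ball (pmm_point (X i)) n%:R) <= S)%E.
  apply: (@le_trans _ _ (pmm_measure (X i) (ball (pmm_point (X i)) n.+1%:R))).
    apply: le_measure; rewrite ?inE; [exact: borel_ball..|].
    by apply: le_ball; rewrite ler_nat.
  by apply: ereal_sup_ubound; exists i.
exists (fine S) => i; rewrite fineK ?le// ge0_fin_numE//.
exact: le_trans (measure_ge0 _ _) (le 0%N).
Qed.

Lemma totally_bounded_wpmGH_cvg :
  uniformly_boundedly_finite X -> boundedly_mt_totally_bounded X ->
  exists2 t : nat -> nat, increasing_seq t &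
    exists Y : pmmSpace R, wpmGH_cvg (X \o t) Y.
Proof.
move=> ubf btb.
(* The ratio [1 / 2] gives summability, the factor [1 / 8] the bound [eta_small]. *)
pose eta : nat -> R := geometric (1 / 8) (1 / 2).
have eta_gt0 k : 0 < eta k by rewrite /eta /geometric /= mulr_gt0 ?exprn_gt0//; lra.
have half1 : `|1 / 2 : R| < 1 by rewrite ger0_norm; lra.
have eta_cvg0 : eta @ \oo --> 0 by exact: cvg_geometric.
have etaS k : eta k.+1 <= eta k.
  by have := eta_gt0 k; rewrite /eta /geometric /= exprS; lra.
have eta_small k : eta k <= 1 / 8.
  elim: k => [|k IH]; first by rewrite /eta /geometric /= expr0 mulr1.
  exact: le_trans (etaS k) IH.
have eta_sum : (\sum_(k <oo) (eta k)%:E < +oo)%E.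
  apply: (@le_lt_trans _ _ ((1 / 8) / (1 - 1 / 2))%:E); last exact: ltry.
  apply: lime_le.
    by apply: is_cvg_nneseries => k _ _; rewrite lee_fin ltW.
  apply: nearW => n; rewrite sumEFin lee_fin.
  by apply: geometric_le_lim => //; lra.
have [|M [pt [M_gt0 pt0 pt_bound pt_cover]]] := totally_bounded_nets _ btb (eta := eta).
  by move=> k; rewrite eta_gt0 /=; have := eta_small k; lra.
have [mass massP] := uniformly_bounded_mass ubf.
have [F [FU ooF]] := @ultraFilterLemma nat \oo _.
have [E [N [mE mN lebN cohN posN]]] := code_realization (fun k => ltn0Sn (M k))
  (cell_mass_ge0 M pt eta FU massP) (cell_mass_children M pt eta FU massP).
have mG : measurable (good_set M E N) by exact: measurable_good_set.
have mT : measurable_fun setT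
    (limit_map M FU pt_bound E N : measurableTypeR R -> borel (limit_space FU pt_bound)).
  exact: (measurable_limit_map massP eta_cvg0 mE mN cohN posN).
have [mY [mYE mYI]] := @restricted_pushforward _ _ (measurableTypeR R)
  (borel (limit_space FU pt_bound)) R lebesgue_measure _ _ mG mT.
have [t tI tc] : exists2 t : nat -> nat, increasing_seq t &
    forall k, close_at M pt eta F k (t k).
  (* [F] contains all tails, so each set of [F] contains arbitrarily large indices. *)
  apply: increasing_choice => k n.
  have FP := @ultra_proper _ _ FU.
  have Fn : F [set i | (n <= i)%N] by apply: ooF; exists n.
  have [i [ni ci]] := @filter_ex _ F FP _
    (@filterI _ F _ _ _ Fn (near_close_at M FU pt_bound massP eta_gt0 k)).
  by exists i.
exists t => //; exists (limit_pmm mY).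
split; first exact: (limit_pmm_finite pt0 massP eta_cvg0 mE mN lebN cohN posN mYE).
exists (fun k => k.+1%:R), (fun k => 4 * eta k).
exists (fun k => limit_approx M eta mY (i := t k) k); split.
- split; first by move=> m n mn; rewrite ler_nat ltnS.
  apply/cvgryPge => A; exists (Num.trunc A) => // k /= Ak.
  by apply: ltW; apply: lt_le_trans (truncnS_gt A) _; rewrite ler_nat ltnS.
- split.
    apply/nonincreasing_seqP => k; rewrite ler_wpM2l//; lra.
  by rewrite -(mulr0 4); apply: cvgM => //; exact: cvg_cst.
- move=> k; exact: (limit_weak_approximation pt0 massP eta_gt0 eta_cvg0
    pt_cover mE mN lebN cohN posN mYE).
- move=> phi phiC; exact: (limit_integral_cvg pt0 massP eta_cvg0 eta_sum
    pt_cover mE mN lebN cohN posN mYI).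
Qed.

End sufficiency.

Lemma uniformly_boundedly_finite_comp (R : realType) (X : nat -> pmmSpace R)
    (s : nat -> nat) :
  uniformly_boundedly_finite X -> uniformly_boundedly_finite (X \o s).
Proof.
move=> ubf r r0; apply: le_lt_trans (ubf r r0); apply: ge_ereal_sup => _ [i _ <-].
by apply: ereal_sup_ubound; exists (s i).
Qed.

Lemma boundedly_mt_totally_bounded_comp (R : realType) (X : nat -> pmmSpace R)
    (s : nat -> nat) :
  boundedly_mt_totally_bounded X -> boundedly_mt_totally_bounded (X \o s).
Proof.
move=> btb r0 r e r00 rp e0; have [M [x hx]] := btb r0 r e r00 rp e0.
exists M, (fun i => x (s i)); apply: le_trans hx; apply: ge_ereal_sup => _ [i _ <-].
by apply: ereal_sup_ubound; exists (s i).
Qed.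

Theorem theorem11p4 (R : realType) (X : nat -> pmmSpace R)
    (hX : forall i, boundedly_finite (X i)) :
  wpmGH_precompact X <->
  uniformly_boundedly_finite X /\ boundedly_mt_totally_bounded X.
Proof.
split=> [pX|[ubf btb] s sI].
  split; first exact: wpmGH_precompact_bounded.
  exact: wpmGH_precompact_totally_bounded.
apply: totally_bounded_wpmGH_cvg.
  exact: uniformly_boundedly_finite_comp.
exact: boundedly_mt_totally_bounded_comp.
Qed.
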